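(* Suppose the weighted composition operators $C_{\phi_i,\omega_i}$ ($i=1,2$) in $L^2(\mu)$ are densely defined, and fix $\lambda\in(0,1)$. Consider the following conditions: (i) $\widehat{\mathcal{M}_\lambda(\mathbf{C}_{\phi,\omega})}^{\,k}$ is densely defined for some $k\in\mathbb{N}\setminus\{1\}$; (ii) $(C_{\phi_1,\omega_1},C_{\phi_2,\omega_2})^k$ is densely defined for some $k\in\mathbb{N}\setminus\{1\}$; (iii) $\mathcal{M}_\lambda(\mathbf{C}_{\phi,\omega})$ is densely defined. Then (i) $\Rightarrow$ (ii) $\Rightarrow$ (iii). Moreover, if $k=2$, then (iii) $\Rightarrow$ (ii) holds; that is, if $\mathcal{M}_\lambda(\mathbf{C}_{\phi,\omega})$ is densely defined, then $(C_{\phi_1,\omega_1},C_{\phi_2,\omega_2})^2$ is densely defined.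
   Context: $(X,\mathscr{A},\mu)$ is a $\sigma$-finite measure space and $L^2(\mu)$ is the complex Hilbert space; $\mathbb{N}=\{1,2,\dots\}$. For an $\mathscr{A}$-measurable transformation $\phi:X\to X$ and an $\mathscr{A}$-measurable $\omega:X\to\mathbb{C}$, put $\mu_\omega(\Delta)=\int_\Delta|\omega|^2d\mu$. The weighted composition operator $C_{\phi,\omega}$ in $L^2(\mu)$ has domain $\{f\in L^2(\mu):\omega\cdot(f\circ\phi)\in L^2(\mu)\}$ and acts by $C_{\phi,\omega}f=\omega\cdot(f\circ\phi)$. It is always assumed that $\mu_\omega\circ\phi^{-1}\ll\mu$ (so $C_{\phi,\omega}$ is well-defined). A tuple $\mathbf{T}=(T_1,\dots,T_n)$ of (unbounded) operators has joint domain $\mathcal{D}(\mathbf{T})=\bigcap_i\mathcal{D}(T_i)$ and is densely defined if $\mathcal{D}(\mathbf{T})$ is dense. The product of $\mathbf{T}=(T_1,\dots,T_n)$ and $\mathbf{S}=(S_1,\dots,S_m)$ is the $nm$-tuple $\mathbf{T}\mathbf{S}=(T_1S_1,\dots,T_1S_m,T_2S_1,\dots,T_nS_m)$ (with natural domains of operator products), and $\mathbf{T}^1=\mathbf{T}$, $\mathbf{T}^{k+1}=\mathbf{T}\mathbf{T}^k$ for $k\in\mathbb{N}$. A pair $\mathbf{C}_{\phi,\omega}=(C_{\phi_1,\omega_1},C_{\phi_2,\omega_2})$ is also identified with the column operator $f\mapsto\binom{C_{\phi_1,\omega_1}f}{C_{\phi_2,\omega_2}f}$; when both components are densely defined it is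 densely defined and closed. Let $\mathbf{C}_{\phi,\omega}=\binom{U_1}{U_2}|\mathbf{C}_{\phi,\omega}|$ be its polar decomposition. The $\lambda$-spherical mean transform is $$\mathcal{M}_\lambda(\mathbf{C}_{\phi,\omega})=\big(\lambda U_1|\mathbf{C}_{\phi,\omega}|+(1-\lambda)|\mathbf{C}_{\phi,\omega}|U_1,\ \lambda U_2|\mathbf{C}_{\phi,\omega}|+(1-\lambda)|\mathbf{C}_{\phi,\omega}|U_2\big).$$ For a single densely defined (automatically closed) $C_{\phi,\omega}$ with polar decomposition $C_{\phi,\omega}=U|C_{\phi,\omega}|$, the $\lambda$-mean transform is $\mathcal{M}_\lambda(C_{\phi,\omega})=\lambda U|C_{\phi,\omega}|+(1-\lambda)|C_{\phi,\omega}|U$. All sums and products carry their natural domains. The toral $\lambda$-spherical mean transform of the pair is $\widehat{\mathcal{M}_\lambda(\mathbf{C}_{\phi,\omega})}=(\mathcal{M}_\lambda(C_{\phi_1,\omega_1}),\mathcal{M}_\lambda(C_{\phi_2,\omega_2}))$. *)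

(* Defs.v *)
From HB Require Import structures.
From mathcomp Require Import all_boot all_order all_algebra.
From mathcomp Require Import generic_quotient ring_quotient.
From mathcomp Require Import complex.
From mathcomp Require Import all_classical all_reals.
From mathcomp Require Import ereal topology normedtype sequences exp measure.
From mathcomp Require Import measurable_realfun lebesgue_measure.
From mathcomp Require Import lebesgue_integral hoelder.

Set Implicit Arguments.
Unset Strict Implicit.
Unset Printing Implicit Defensive.

Import Order.TTheory GRing.Theory Num.Theory.
Import ComplexField.Normc.
Import numFieldNormedType.Exports.

Local Open Scope classical_set_scope.
Local Open Scope ring_scope.
Local Open Scope complex_scope.
Local Open Scope quotient_scope.

Local Notation Re := complex.Re.
Local Notation Im := complex.Im.

(* The inner product is linear in its first argument and conjugate-linear in
   the second one. Completeness is not required by the definitions below. *)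
HB.mixin Record Lmodule_hasDot (R : realType) V & GRing.Lmodule R[i] V := {
  dotp : {dot V for @conjc R}
}.

#[short(type="innerProductType")]
HB.structure Definition InnerProduct (R : realType) :=
  {V of Lmodule_hasDot R V & GRing.Lmodule R[i] V}.

Definition hnorm (R : realType) (H : innerProductType R) (x : H) : R :=
  Num.sqrt (Re (dotp x x)).

(* Pairs carry the Hilbert direct sum structure, not the max norm that the
   library puts on products of normed modules. *)
Section PairDot.
Context (R : realType) (H K : innerProductType R).

Definition dot_pair (x y : (H * K)%type) : R[i] :=
  dotp x.1 y.1 + dotp x.2 y.2.

Let dot_pair_bilinear :
  bilinear_for ( *%R : GRing.Scale.law _ _)
    (@conjc R \; *%R : GRing.Scale.law _ _) dot_pair.
Proof.
split=> [y|x] a u v; rewrite /dot_pair /=.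
- by rewrite !linearPl /= mulrDr addrACA.
- by rewrite !linearPr /= mulrDr addrACA.
Qed.

HB.instance Definition _ :=
  bilinear_isBilinear.Build R[i] (H * K)%type (H * K)%type R[i] _ _ dot_pair
    dot_pair_bilinear.

Let dot_pair_herm (x y : H * K) :
  dot_pair x y = (-1) ^+ false * conjc (dot_pair y x).
Proof.
rewrite /dot_pair [in LHS]hermC [X in _ + X]hermC /= !expr0 !mul1r.
by rewrite rmorphD.
Qed.

HB.instance Definition _ :=
  isHermitianSesquilinear.Build R[i] (H * K)%type false (@conjc R) dot_pair
    dot_pair_herm.

Let dot_pair_gt0 (x : H * K) : x != 0 -> 0 < dot_pair x x.
Proof.
have dge0 (V : innerProductType R) (v : V) : 0 <= dotp v v.
  have [->|/neq0_dnorm_gt0 /ltW //] := eqVneq v 0.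
  by rewrite linear0l.
case: x => x y; rewrite /dot_pair -pair_eqE /= negb_and => /orP[] n0.
- by apply: ltr_wpDr; [exact: dge0|exact: neq0_dnorm_gt0].
- by apply: ltr_wpDl; [exact: dge0|exact: neq0_dnorm_gt0].
Qed.

HB.instance Definition _ :=
  isDotProduct.Build R[i] (H * K)%type dot_pair dot_pair_gt0.

HB.instance Definition _ := Lmodule_hasDot.Build R (H * K)%type
  [the {dot (H * K)%type for @conjc R} of dot_pair].

End PairDot.

Section ComplexL2.
Context d (X : measurableType d) (R : realType).
Variable mu : {measure set X -> \bar R}.

(* Borel measurability of a complex-valued function. *)
Definition cmeasurable (f : X -> R[i]) : Prop :=
  measurable_fun setT (fun x => Re (f x)) /\ measurable_fun setT (fun x => Im (f x)).

Definition cintegral (f : X -> R[i]) : R[i] :=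
  (\int[mu]_x Re (f x)) +i* (\int[mu]_x Im (f x)).

Definition sqint : {pred X -> R[i]} := mem [set f | cmeasurable f /\
  (\int[mu]_x ((normc (f x)) ^+ 2)%:E < +oo)%E].

Let normc2E (z : R[i]) : normc z ^+ 2 = Re z ^+ 2 + Im z ^+ 2.
Proof. by case: z => a b; rewrite /= sqr_sqrtr// addr_ge0 ?sqr_ge0. Qed.

Let Lfun2P (g : X -> R) : measurable_fun setT g ->
  (\int[mu]_x ((g x) ^+ 2)%:E < +oo)%E -> g \in Lfun mu 2%:E.
Proof.
move=> mg gi; rewrite inE; apply/andP; split; rewrite inE//= /finite_norm.
rewrite unlock /Lnorm poweR_lty//.
by under eq_integral => x _ do
  rewrite /= powR_mulrn ?normr_ge0// real_normK ?num_real//.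
Qed.

Lemma sqintP (f : X -> R[i]) : reflect
  ((fun x => Re (f x)) \in Lfun mu 2%:E /\ (fun x => Im (f x)) \in Lfun mu 2%:E) (f \in sqint).
Proof.
apply: (iffP idP).
- rewrite inE => -[[mr mi] fi].
  have mn : @measurable_fun _ _ X (\bar R) setT
      (EFin \o ((fun x => (Re (f x)) ^+ 2) \+ (fun x => (Im (f x)) ^+ 2))).
    apply/measurable_EFinP.
    by apply: measurable_funD; exact: measurable_funX.
  have {}fi : (\int[mu]_x (Re (f x) ^+ 2 + Im (f x) ^+ 2)%:E < +oo)%E.
    by under eq_integral do rewrite -normc2E.
  split; apply: Lfun2P => //; apply: le_lt_trans fi; apply: ge0_le_integral => //.
  + by move=> x _; rewrite lee_fin sqr_ge0.
  + by apply/measurable_EFinP; exact: measurable_funX.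
  + by move=> x _; rewrite lee_fin lerDl sqr_ge0.
  + by move=> x _; rewrite lee_fin sqr_ge0.
  + by apply/measurable_EFinP; exact: measurable_funX.
  + by move=> x _; rewrite lee_fin lerDr sqr_ge0.
- move=> [fr fi]; rewrite inE; split.
    by split; [move: fr|move: fi]; rewrite inE => /andP[/[!inE]].
  under eq_integral do rewrite normc2E EFinD.
  have /integrableP[mr ir] := Lfun2_integrable_sqr fr.
  have /integrableP[mi ii] := Lfun2_integrable_sqr fi.
  rewrite ge0_integralD//=; first apply: lte_add_pinfty.
  + by move: ir; under eq_integral do rewrite /= ger0_norm ?sqr_ge0//.
  + by move: ii; under eq_integral do rewrite /= ger0_norm ?sqr_ge0//.
  + by move=> x _; rewrite lee_fin sqr_ge0.
  + by move=> x _; rewrite lee_fin sqr_ge0.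
Qed.

Let le12 : (1 <= 2%:E :> \bar R)%E.
Proof. by rewrite lee_fin ler1n. Qed.

Let sqint_submod_closed : submod_closed sqint.
Proof.
split.
  apply/sqintP; split; rewrite (_ : (fun _ => _) = 0) ?rpred0//;
    exact: (GRing.submod_closed_semi (Lfun_submod_closed mu le12)).1.
move=> a f g /sqintP[fr fi] /sqintP[gr gi].
have lin := (Lfun_submod_closed mu le12).2.
have N0 : (cst 0 : X -> R) \in Lfun mu 2%:E := (Lfun_submod_closed mu le12).1.
have Z b h : h \in Lfun mu 2%:E -> b *: h \in Lfun mu 2%:E.
  by move=> hP; have := lin b _ _ hP N0; rewrite [cst 0](_ : _ = 0)// addr0.
case: a => a b; apply/sqintP; split.
- rewrite (_ : (fun _ => _) = a *: (fun x => Re (f x)) +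
      ((- b) *: (fun x => Im (f x)) + (fun x => Re (g x)))).
    by apply: (lin) => //; apply: (lin) => //; apply: Z.
  apply/funext => x /=; rewrite !fctE /=.
  by case: (f x) (g x) => [u v] [s t] /=; rewrite scaleNr addrA.
- rewrite (_ : (fun _ => _) = a *: (fun x => Im (f x)) +
      (b *: (fun x => Re (f x)) + (fun x => Im (g x)))).
    by apply: (lin) => //; apply: (lin) => //; apply: Z.
  apply/funext => x /=; rewrite !fctE /=.
  by case: (f x) (g x) => [u v] [s t] /=; rewrite addrA.
Qed.

HB.instance Definition _ :=
  GRing.isSubmodClosed.Build _ _ sqint sqint_submod_closed.

(* L2 is the space of square-integrable functions modulo equality almost
   everywhere; L2_to_fun picks a representative of a class. *)
Record L2fun := MkL2fun { L2fun_val :> X -> R[i]; _ : L2fun_val \in sqint }.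

HB.instance Definition _ := [isSub for L2fun_val].
HB.instance Definition _ := [Choice of L2fun by <:].
HB.instance Definition _ := [SubChoice_isSubLmodule of L2fun by <:].

Definition ae_null : {pred L2fun} :=
  mem [set f : L2fun | \forall x \ae mu, f x = 0].

Let ae_null_lin : submod_closed ae_null.
Proof.
split; first by rewrite inE /=; apply: aeW.
move=> a f g; rewrite !inE /= => f0 g0.
by apply: filterS2 f0 g0 => x /= fx gx; rewrite !fctE fx gx scaler0 addr0.
Qed.

HB.instance Definition _ := GRing.isSubmodClosed.Build _ _ ae_null ae_null_lin.

Definition L2 : Type := Quotient.quot ae_null.

HB.instance Definition _ := GRing.Zmodule.on L2.

Definition L2_to_fun (f : L2) : X -> R[i] := repr f.
Coercion L2_to_fun : L2 >-> Funclass.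

Definition L2_class (f : L2fun) : L2 := \pi_L2 f.

Lemma L2_classP (f g : L2fun) :
  L2_class f = L2_class g <-> \forall x \ae mu, f x = g x.
Proof.
rewrite /L2_class; split.
- move/eqP; rewrite -Quotient.idealrBE inE /=; apply: filterS => x.
  by rewrite !fctE => /subr0_eq.
- move=> fg; apply/eqP; rewrite -Quotient.idealrBE inE /=.
  by apply: filterS fg => x; rewrite !fctE => ->; rewrite subrr.
Qed.

Lemma L2_reprK (f : L2) : L2_class (repr f) = f.
Proof. exact: reprK. Qed.

Lemma L2_classE (f : L2fun) : \forall x \ae mu, L2_class f x = f x.
Proof. by apply/L2_classP; rewrite L2_reprK. Qed.

Lemma L2_eqP (f g : L2) : f = g <-> \forall x \ae mu, f x = g x.
Proof. by rewrite -L2_classP !L2_reprK. Qed.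

Definition L2_scale (a : R[i]) (f : L2) : L2 := L2_class (a *: repr f).

Lemma L2_classZ a f : L2_scale a (L2_class f) = L2_class (a *: f).
Proof.
apply/L2_classP; have := L2_classE f.
by apply: filterS => x fx; change (a * L2_class f x = a * f x); rewrite fx.
Qed.

Lemma L2_classD f g : L2_class (f + g) = L2_class f + L2_class g.
Proof. exact: raddfD. Qed.


Let L2_scaleA a b f : L2_scale a (L2_scale b f) = L2_scale (a * b) f.
Proof. by rewrite -[f]L2_reprK !L2_classZ scalerA. Qed.

Let L2_scale1 : left_id 1 L2_scale.
Proof. by move=> f; rewrite -[f]L2_reprK !L2_classZ scale1r. Qed.

Let L2_scaleDr : right_distributive L2_scale +%R.
Proof.
move=> a f g; rewrite -[f]L2_reprK -[g]L2_reprK -L2_classD !L2_classZ.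
by rewrite scalerDr L2_classD.
Qed.

Let L2_scaleDl f : {morph L2_scale^~ f : a b / a + b}.
Proof.
by move=> a b; rewrite -[f]L2_reprK !L2_classZ scalerDl L2_classD.
Qed.

HB.instance Definition _ := GRing.Zmodule_isLmodule.Build R[i] L2
  L2_scaleA L2_scale1 L2_scaleDr L2_scaleDl.

Lemma L2_linE (a : R[i]) (f g : L2) :
  \forall x \ae mu, (a *: f + g : L2) x = a * f x + g x.
Proof.
have -> : a *: f + g = L2_class (a *: repr f + repr g).
  by rewrite L2_classD L2_reprK.
exact: L2_classE.
Qed.

Definition L2_dot (f g : L2) : R[i] := cintegral (fun x => f x * (g x)^*).

Lemma L2_sqint (f : L2) : (f : X -> R[i]) \in sqint.
Proof. exact: valP. Qed.

Definition cintegrable (F : X -> R[i]) : Prop :=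
  mu.-integrable setT (EFin \o fun x => Re (F x)) /\
  mu.-integrable setT (EFin \o fun x => Im (F x)).

Lemma L2_dot_integrable (f g : L2) : cintegrable (fun x => f x * (g x)^*).
Proof.
have /sqintP[fr fi] := L2_sqint f; have /sqintP[gr gi] := L2_sqint g.
have I u v : u \in Lfun mu 2%:E -> v \in Lfun mu 2%:E ->
    mu.-integrable setT (fun x => (u x * v x)%:E).
  by move=> uP vP; have /Lfun1_integrable := Lfun2_mul_Lfun1 uP vP.
split.
- rewrite (_ : _ \o _ =
    (fun x => (Re (f x) * Re (g x))%:E + (Im (f x) * Im (g x))%:E)%E).
    by apply: integrableD => //; apply: I.
  apply/funext => x /=; case: (f x) (g x) => [a b] [s t] /=.
  by rewrite mulrN opprK EFinD.
- rewrite (_ : _ \o _ =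
    (fun x => (Im (f x) * Re (g x))%:E - (Re (f x) * Im (g x))%:E)%E).
    by apply: integrableB => //; apply: I.
  apply/funext => x /=; case: (f x) (g x) => [a b] [s t] /=.
  by rewrite mulrN EFinD EFinN addeC.
Qed.

Let ae_eq_Rintegral (u v : X -> R) :
  mu.-integrable setT (EFin \o u) -> mu.-integrable setT (EFin \o v) ->
  (\forall x \ae mu, u x = v x) -> \int[mu]_x u x = \int[mu]_x v x.
Proof.
move=> ui vi uv; rewrite /Rintegral; congr fine; apply: ae_eq_integral => //.
- exact: measurable_int ui.
- exact: measurable_int vi.
- by apply: filterS uv => x /= ->.
Qed.

Lemma cintegral_linear (a : R[i]) (F G H : X -> R[i]) :
  cintegrable F -> cintegrable G -> cintegrable H ->
  (\forall x \ae mu, F x = a * G x + H x) ->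
  cintegral F = a * cintegral G + cintegral H.
Proof.
move=> [Fr Fi] [Gr Gi] [Hr Hi] FGH; case: a FGH => a b FGH.
have Z c u : mu.-integrable setT (EFin \o u) ->
    mu.-integrable setT (EFin \o (fun x => c * u x)).
  by move=> ui; have := integrableZl measurableT c ui.
have D u v : mu.-integrable setT (EFin \o u) ->
    mu.-integrable setT (EFin \o v) ->
    mu.-integrable setT (EFin \o (fun x => u x + v x)).
  by move=> ui vi; have := integrableD measurableT ui vi.
have E1 : \int[mu]_x Re (F x) =
    \int[mu]_x (a * Re (G x) + (- b * Im (G x) + Re (H x))).
  apply: ae_eq_Rintegral => //; first by do ?apply: (D); do ?apply: Z.
  apply: filterS FGH => x ->.
  by case: (G x) (H x) => [g1 g2] [h1 h2] /=; rewrite mulNr addrA.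
have E2 : \int[mu]_x Im (F x) =
    \int[mu]_x (a * Im (G x) + (b * Re (G x) + Im (H x))).
  apply: ae_eq_Rintegral => //; first by do ?apply: (D); do ?apply: Z.
  apply: filterS FGH => x ->.
  by case: (G x) (H x) => [g1 g2] [h1 h2] /=; rewrite addrA.
rewrite /cintegral E1 E2.
rewrite !RintegralD ?RintegralZl //; try by do ?apply: (D); do ?apply: (Z).
by apply/eqP; rewrite eq_complex /= mulNr !addrA !eqxx.
Qed.

Let L2_dot_linearl (h : L2) a (f g : L2) :
  L2_dot (a *: f + g) h = a * L2_dot f h + L2_dot g h.
Proof.
apply: cintegral_linear; try exact: L2_dot_integrable.
by apply: filterS (L2_linE a f g) => x ->; rewrite mulrDl mulrA.
Qed.

Let L2_dotC (f g : L2) : L2_dot f g = (L2_dot g f)^*.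
Proof.
have IN (u : X -> R) : mu.-integrable setT (EFin \o u) ->
    \int[mu]_x (- u x) = - \int[mu]_x u x.
  by move=> ui; rewrite -mulN1r -RintegralZl//; under eq_Rintegral do rewrite -mulN1r.
rewrite /L2_dot /cintegral /=; congr (_ +i* _).
- by apply: eq_Rintegral => x _; case: (f x) (g x) => [a b] [s t] /=;
    rewrite !mulrN (mulrC a) (mulrC b).
- rewrite -IN; last exact: (L2_dot_integrable g f).2.
  apply: eq_Rintegral => x _; case: (f x) (g x) => [a b] [s t] /=.
  by rewrite !mulrN opprD opprK addrC (mulrC b) (mulrC a).
Qed.

Let L2_dot_bilinear :
  bilinear_for ( *%R : GRing.Scale.law _ _)
    (@conjc R \; *%R : GRing.Scale.law _ _) L2_dot.
Proof.
split=> [h|h] a f g; first exact: L2_dot_linearl.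
rewrite [LHS]L2_dotC L2_dot_linearl (L2_dotC h f) (L2_dotC h g) /=.
by rewrite -[RHS]/((a^*) * _ + _) rmorphD rmorphM.
Qed.

HB.instance Definition _ :=
  bilinear_isBilinear.Build R[i] L2 L2 R[i] _ _ L2_dot L2_dot_bilinear.

Let L2_dot_herm (f g : L2) : L2_dot f g = (-1) ^+ false * conjc (L2_dot g f).
Proof. by rewrite expr0 mul1r -L2_dotC. Qed.

HB.instance Definition _ :=
  isHermitianSesquilinear.Build R[i] L2 false (@conjc R) L2_dot L2_dot_herm.

Let L2_dot_gt0 (f : L2) : f != 0 -> 0 < L2_dot f f.
Proof.
move=> f0; have [fr _] := L2_dot_integrable f f.
have ReE x : Re (f x * (f x)^*) = Re (f x) ^+ 2 + Im (f x) ^+ 2.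
  by case: (f x) => a b /=; rewrite mulrN opprK !expr2.
have Re0 x : 0 <= Re (f x * (f x)^*) by rewrite ReE addr_ge0 ?sqr_ge0.
have -> : L2_dot f f = (\int[mu]_x Re (f x * (f x)^*))%:C.
  rewrite /L2_dot /cintegral; apply/eqP; rewrite eq_complex /= eqxx /=.
  rewrite (@eq_Rintegral _ _ _ _ _ (cst 0)) ?Rintegral_cst ?mul0r//.
  by move=> x _; case: (f x) => a b /=; rewrite mulrN (mulrC b) addNr.
rewrite ltcR lt_neqAle Rintegral_ge0// andbT eq_sym; apply: contra f0 => /eqP i0.
have i0' : (\int[mu]_x `|(Re (f x * (f x)^*))%:E| = 0)%E.
  under eq_integral do rewrite gee0_abs ?lee_fin//.
  have := integrable_fin_num measurableT fr; move/fineK => /= <-.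
  by move: i0; rewrite /Rintegral /= => ->.
have := (ae_eq_integral_abs mu measurableT (measurable_int _ fr)).1 i0'.
move=> f0; apply/eqP/L2_eqP.
have : \forall x \ae mu, (0 : L2) x = 0.
  by rewrite -[0](raddf0 \pi_L2); exact: L2_classE.
apply: filterS2 f0 => x /= /(_ I) [] + ->.
rewrite ReE => /eqP; rewrite paddr_eq0 ?sqr_ge0// !sqrf_eq0 => /andP[].
by case: (f x) => a b /= /eqP-> /eqP->.
Qed.

HB.instance Definition _ := isDotProduct.Build R[i] L2 L2_dot L2_dot_gt0.

HB.instance Definition _ := Lmodule_hasDot.Build R L2
  [the {dot L2 for @conjc R} of L2_dot].

End ComplexL2.

(* An unbounded operator is identified with its graph: T (x, y) means that x is
   in the domain of T and that T x = y. *)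
Section Operators.
Context (R : realType).
Implicit Types H K L : innerProductType R.

Definition operator H K := set (H * K)%type.

Definition opdom H K (T : operator H K) : set H := [set x | exists y, T (x, y)].

Definition opker H K (T : operator H K) : set H := [set x | T (x, 0)].

Definition is_operator H K (T : operator H K) : Prop :=
  [/\ T (0, 0),
      forall (a : R[i]) u v, T u -> T v -> T (a *: u + v)
    & forall y, T (0, y) -> y = 0].

Definition hdense H (D : set H) : Prop :=
  forall (x : H) (e : R), 0 < e -> exists2 y, D y & hnorm (x - y) < e.

Definition fun_op H K (U : H -> K) : operator H K := [set xy | xy.2 = U xy.1].

Definition comp_op H K L (S : operator K L) (T : operator H K) : operator H L :=
  [set xz | exists2 y, T (xz.1, y) & S (y, xz.2)].

Definition add_op H K (S T : operator H K) : operator H K :=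
  [set xy | exists y1 y2, [/\ S (xy.1, y1), T (xy.1, y2) & xy.2 = y1 + y2]].

Definition scale_op H K (a : R[i]) (T : operator H K) : operator H K :=
  [set xy | exists2 y, T (xy.1, y) & xy.2 = a *: y].

Definition adjoint H K (T : operator H K) : operator K H :=
  [set yz | forall x w, T (x, w) -> dotp w yz.1 = dotp x yz.2].

Definition column_op H K L (S : operator H K) (T : operator H L) :
    operator H (K * L)%type :=
  [set xy | S (xy.1, xy.2.1) /\ T (xy.1, xy.2.2)].

Definition positive_selfadjoint H (A : operator H H) : Prop :=
  [/\ hdense (opdom A), adjoint A = A
    & forall x y, A (x, y) -> 0 <= dotp y x].

Definition bounded_fun H K (U : H -> K) : Prop :=
  exists M : R, forall x, hnorm (U x) <= M * hnorm x.

Definition partial_isometry H K (U : {linear H -> K}) : Prop :=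
  bounded_fun U /\
  forall x, (forall z, U z = 0 -> dotp x z = 0) -> hnorm (U x) = hnorm x.

(* A = |T| is the positive self-adjoint square root of T^* T. *)
Definition is_modulus H K (T : operator H K) (A : operator H H) : Prop :=
  positive_selfadjoint A /\ comp_op A A = comp_op (adjoint T) T.

Definition polar_decomposition H K (T : operator H K) (U : {linear H -> K})
    (A : operator H H) : Prop :=
  [/\ is_modulus T A, partial_isometry U, T = comp_op (fun_op U) A
    & [set x | U x = 0] = opker T].

(* V is a component of the partial isometry of a polar decomposition with
   modulus A. *)
Definition mean_op H (l : R) (V : H -> H) (A : operator H H) : operator H H :=
  add_op (scale_op l%:C (comp_op (fun_op V) A))
         (scale_op (1 - l)%:C (comp_op A (fun_op V))).

(* Finite tuples of operators are sequences; allpairs enumerates the products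
   in the order T1 S1, ..., T1 Sm, T2 S1, ..., Tn Sm. *)
Definition joint_dom H (T : seq (operator H H)) : set H :=
  \big[setI/setT]_(t <- T) opdom t.

Definition tuple_mul H (T S : seq (operator H H)) : seq (operator H H) :=
  [seq comp_op t s | t <- T, s <- S].

(* T^1 = T and T^(k+1) = T T^k; the value at k = 0 plays no role. *)
Definition tuple_pow H (T : seq (operator H H)) (k : nat) :
    seq (operator H H) :=
  iterop k (@tuple_mul H) T [:: fun_op idfun].

Definition jointly_densely_defined H (T : seq (operator H H)) : Prop :=
  hdense (joint_dom T).

End Operators.

Section WeightedComposition.
Context d (X : measurableType d) (R : realType).
Variable mu : {measure set X -> \bar R}.
Implicit Types (phi : X -> X) (w : X -> R[i]).

Definition weighted_measure w : set X -> \bar R :=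
  fun D => (\int[mu]_(x in D) ((normc (w x)) ^+ 2)%:E)%E.

Definition wcomp_symbol phi w : Prop :=
  [/\ measurable_fun setT phi, cmeasurable w
    & pushforward (weighted_measure w) phi `<< mu].

(* The existence of the value in L2 encodes the domain condition
   w * (f o phi) \in L^2(mu). *)
Definition wcomp_op phi w : operator (L2 mu) (L2 mu) :=
  [set fg : L2 mu * L2 mu | \forall x \ae mu, fg.2 x = w x * fg.1 (phi x)].

Lemma wcomp_ae phi w (f g : X -> R[i]) : wcomp_symbol phi w ->
  (\forall x \ae mu, f x = g x) ->
  \forall x \ae mu, w x * f (phi x) = w x * g (phi x).
Proof.
move=> [mphi [mr mi] /null_content_dominatesP ac] [N [mN N0 fgN]].
have mP : measurable (phi @^-1` N) by rewrite -[_ @^-1` _]setTI; exact: mphi.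
have normc2E (z : R[i]) : normc z ^+ 2 = Re z ^+ 2 + Im z ^+ 2.
  by case: z => a b; rewrite /= sqr_sqrtr// addr_ge0 ?sqr_ge0.
have mw : measurable_fun (phi @^-1` N) (fun x => ((normc (w x)) ^+ 2)%:E : \bar R).
  apply/measurable_EFinP; rewrite (_ : (fun _ => _) =
    (fun x => (Re (w x)) ^+ 2) \+ (fun x => (Im (w x)) ^+ 2)).
    by apply: measurable_funTS; apply: measurable_funD; exact: measurable_funX.
  by apply/funext => x; rewrite normc2E.
have w0 : (\int[mu]_(x in phi @^-1` N) `|((normc (w x)) ^+ 2)%:E| = 0)%E.
  under eq_integral do rewrite gee0_abs ?lee_fin ?sqr_ge0//.
  exact: ac mN N0.
have := (ae_eq_integral_abs mu mP mw).1 w0.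
apply: filterS => x /= wx.
have [Nx|Nx] := pselect (N (phi x)).
  have [/eqP] := wx Nx.
  by rewrite sqrf_eq0 => /eqP /eq0_normc ->; rewrite !mul0r.
by congr (_ * _); apply: contrapT => fg; apply/Nx/fgN.
Qed.

Lemma wcomp_op_class phi w (f g : L2fun mu) : wcomp_symbol phi w ->
  wcomp_op phi w (L2_class f, L2_class g) <->
  \forall x \ae mu, g x = w x * f (phi x).
Proof.
move=> pw; have fE := wcomp_ae pw (L2_classE f).
by split; rewrite /wcomp_op /=; apply: filterS3 (L2_classE g) fE => x -> ->.
Qed.

Lemma wcomp_op_dom phi w (f : L2 mu) : wcomp_symbol phi w ->
  opdom (wcomp_op phi w) f <-> (fun x => w x * f (phi x)) \in sqint mu.
Proof.
move=> pw; have [mphi [wr wi] _] := pw.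
have normcE (z : R[i]) : normc z = Num.sqrt (Re z ^+ 2 + Im z ^+ 2).
  by case: z.
have mabs (h : X -> R[i]) : cmeasurable h ->
    measurable_fun setT (fun x => ((normc (h x)) ^+ 2)%:E : \bar R).
  move=> [hr hi]; apply/measurable_EFinP; rewrite (_ : (fun _ => _) =
    (fun x => (Re (h x)) ^+ 2) \+ (fun x => (Im (h x)) ^+ 2)).
    by apply: measurable_funD; exact: measurable_funX.
  by apply/funext => x; rewrite normcE sqr_sqrtr// addr_ge0 ?sqr_ge0.
have mwf : cmeasurable (fun x => w x * f (phi x)).
  have := L2_sqint f; rewrite inE => -[[fr fi] _].
  have fpr : measurable_fun setT (fun x => Re (f (phi x))).
    exact: (measurableT_comp fr mphi).
  have fpi : measurable_fun setT (fun x => Im (f (phi x))).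
    exact: (measurableT_comp fi mphi).
  split.
  - rewrite (_ : (fun _ => _) =
      ((fun x => Re (w x)) \* (fun x => Re (f (phi x)))) \-
      ((fun x => Im (w x)) \* (fun x => Im (f (phi x))))).
      by apply: measurable_funB; exact: measurable_funM.
    by apply/funext => x /=; case: (w x) (f _) => [a b] [s t].
  - rewrite (_ : (fun _ => _) =
      ((fun x => Re (w x)) \* (fun x => Im (f (phi x)))) \+
      ((fun x => Im (w x)) \* (fun x => Re (f (phi x))))).
      by apply: measurable_funD; exact: measurable_funM.
    by apply/funext => x /=; case: (w x) (f _) => [a b] [s t].
split=> [[g gwf]|wf].
- rewrite inE; split => //.
  have := L2_sqint g; rewrite inE => -[mg]; apply: le_lt_trans.
  rewrite (@ae_eq_integral _ _ _ mu setT (fun x => ((normc ((g : L2 mu) x)) ^+ 2)%:E))//.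
  + exact: mabs.
  + exact: mabs.
  + by apply: filterS gwf => x /= ->.
- by exists (L2_class (MkL2fun wf)); exact: L2_classE.
Qed.

Lemma wcomp_op_is_operator phi w : wcomp_symbol phi w ->
  is_operator (wcomp_op phi w).
Proof.
move=> pw.
have z0 : \forall x \ae mu, (0 : L2 mu) x = 0.
  by rewrite -[0](raddf0 \pi_(L2 mu)); exact: L2_classE.
have zp : \forall x \ae mu, w x * (0 : L2 mu) (phi x) = 0.
  by apply: filterS (wcomp_ae pw z0) => x ->; rewrite mulr0.
split.
- by apply: filterS2 z0 zp => x /= -> ->.
- move=> a [f1 g1] [f2 g2] /= h1 h2.
  have h : \forall x \ae mu,
      w x * (a *: f1 + f2 : L2 mu) (phi x) = a * (g1 : L2 mu) x + (g2 : L2 mu) x.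
    apply: filterS3 (wcomp_ae pw (L2_linE a f1 f2)) h1 h2 => x /= -> -> ->.
    by rewrite mulrDr mulrCA.
  by apply: filterS2 (L2_linE a g1 g2) h => x /= -> ->.
- move=> g h; apply/L2_eqP.
  by apply: filterS3 z0 zp h => x /= -> -> ->.
Qed.

End WeightedComposition.

Arguments wcomp_symbol {d X R} mu phi w.
Arguments wcomp_op {d X R} mu phi w.

(* Main.v *)
Require Import Defs.
From HB Require Import structures.
From mathcomp Require Import all_boot all_order all_algebra.
From mathcomp Require Import complex ring lra.
From mathcomp Require Import all_classical all_reals.
From mathcomp Require Import ereal topology normedtype sequences exp measure.
From mathcomp Require Import measurable_realfun lebesgue_measure.
From mathcomp Require Import numfun lebesgue_integral charge.

(** Write [h_i] for the density of the measure [D |-> mu_(w_i) (phi_i^-1 D)]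
    with respect to [mu], so that [|C_i f|^2] integrates to the integral of
    [h_i |f|^2].  Density of the domain of [C_i] makes this measure sigma-finite,
    so [h_i] exists and is finite ([weight_density_exists]).  Hence [C_i^* C_i] is
    multiplication by [h_i], the column operator has [h := h_1 + h_2] in the same
    role, and its modulus is multiplication by [m := sqrt h] ([modulus_mul]).  The
    components of the partial isometry are then explicit ([polar_component]):
<<
      U_i f = w_i * (f / m) o phi_i.
>>

    With these formulas every domain in the statement becomes an integrability
    condition on [f].

    - Since a product [T S] is only defined where [S] is, the joint domains of the
      powers of a pair decrease with the exponent ([joint_dom_pow]); so only
      exponent 2 matters.

    - The mean [l C_j + (1 - l) |C_j| U_j] acts as multiplication of [C_j f] by
      [l + (1 - l) sqrt (h_j / h_j o phi_j) >= l].  It dominates [l |C_j f|]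
      pointwise, and the domain of [C_i] contains with a function every smaller
      one.  The joint domain of the square of the toral transform is therefore
      contained in that of [(C_1, C_2)^2], whence the first implication.

    - Both the square of the pair and the spherical transform require
      [m f] in [L^2]; beyond that, the square requires [m * C_j f] in [L^2] and
      the spherical transform [m * U_j f], where [C_j f = (m o phi_j) * U_j f].
      Cutting [f] off to a set on which [m] is bounded passes from the second
      condition to the first; cutting it off to a set on which [1 / m] is
      bounded, with [1 / 0 = 0], passes from the first to the second.  In either
      case the truncations converge to [f], so one domain is dense when the other
      one is.

    Moduli are only known through their defining equation, so [A = M_m] needs the
    uniqueness of positive square roots of unbounded operators; the argument in
    [positive_sqrt_unique] is elementary and uses no spectral theorem. *)

Set Implicit Arguments.
Unset Strict Implicit.
Unset Printing Implicit Defensive.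

Import Order.TTheory GRing.Theory Num.Theory.
Import ComplexField.Normc.
Import numFieldNormedType.Exports.

Local Open Scope classical_set_scope.
Local Open Scope ring_scope.
Local Open Scope complex_scope.

Local Notation Re := complex.Re.
Local Notation Im := complex.Im.

(** * Inner product spaces and positive square roots *)

Section InnerProductSpaces.
Context (R : realType).
Implicit Types H K : innerProductType R.

Definition sqnorm H (x : H) : R := Re (dotp x x).

Lemma dotpC H (x y : H) : dotp x y = (dotp y x)^*.
Proof. by rewrite [LHS]hermC /= expr0 mul1r. Qed.

Lemma Re_conj (z : R[i]) : Re z^* = Re z. Proof. by case: z. Qed.

Lemma dotpDl H (x y z : H) : dotp (x + y) z = dotp x z + dotp y z.
Proof. by rewrite linearDl. Qed.
Lemma dotpDr H (x y z : H) : dotp z (x + y) = dotp z x + dotp z y.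
Proof. by rewrite linearDr. Qed.
Lemma dotpZl H a (x z : H) : dotp (a *: x) z = a * dotp x z.
Proof. by rewrite linearZl_LR. Qed.
Lemma dotpZr H a (x z : H) : dotp z (a *: x) = a^* * dotp z x.
Proof. by rewrite linearZr_LR. Qed.
Lemma dotpNl H (x z : H) : dotp (- x) z = - dotp x z.
Proof. by rewrite linearNl. Qed.
Lemma dotpNr H (x z : H) : dotp z (- x) = - dotp z x.
Proof. by rewrite linearNr. Qed.
Lemma dotp0l H (z : H) : dotp 0 z = 0. Proof. by rewrite linear0l. Qed.
Lemma dotp0r H (z : H) : dotp z 0 = 0. Proof. by rewrite linear0r. Qed.

Lemma dotp_ge0 H (x : H) : 0 <= dotp x x.
Proof.
have [->|/neq0_dnorm_gt0 /ltW //] := eqVneq x 0.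
by rewrite dotp0l.
Qed.

Lemma dotp_sqnorm H (x : H) : dotp x x = (sqnorm x)%:C.
Proof.
have := dotp_ge0 x; rewrite /sqnorm; case: (dotp x x) => a b.
by rewrite lecE /= => /andP[/eqP -> _].
Qed.

Lemma sqnorm_ge0 H (x : H) : 0 <= sqnorm x.
Proof. by have := dotp_ge0 x; rewrite dotp_sqnorm lecR. Qed.

Lemma sqnorm_eq0 H (x : H) : sqnorm x = 0 -> x = 0.
Proof.
move=> x0; have [//|n0] := eqVneq x 0.
have : 0 < dotp x x by exact: neq0_dnorm_gt0.
by rewrite dotp_sqnorm x0 ltxx.
Qed.

Lemma sqnormD H (x y : H) :
  sqnorm (x + y) = sqnorm x + sqnorm y + 2 * Re (dotp x y).
Proof.
rewrite /sqnorm dotpDl !dotpDr (dotpC y x) !raddfD /= Re_conj.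
ring.
Qed.

Lemma sqnormZ H (a : R[i]) (x : H) : sqnorm (a *: x) = normc a ^+ 2 * sqnorm x.
Proof.
rewrite /sqnorm dotpZl dotpZr dotp_sqnorm; case: a => a b /=.
rewrite sqr_sqrtr ?addr_ge0 ?sqr_ge0//; ring.
Qed.

Lemma sqnormN H (x : H) : sqnorm (- x) = sqnorm x.
Proof. by rewrite /sqnorm dotpNl dotpNr opprK. Qed.

(** From the parallelogram law; it stands in for the triangle inequality, because
    estimates are made on squared norms. *)
Lemma sqnormD_le H (x y : H) : sqnorm (x + y) <= 2 * (sqnorm x + sqnorm y).
Proof.
have := sqnorm_ge0 (x - y); rewrite !sqnormD sqnormN dotpNr raddfN /=.
by move=> h; lra.
Qed.

Lemma hdenseP H (D : set H) :
  hdense D <-> forall x (e : R), 0 < e -> exists2 y, D y & sqnorm (x - y) < e.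
Proof.
split=> dD x e e0.
- have [|y Dy xy] := dD x (Num.sqrt e); first by rewrite sqrtr_gt0.
  by exists y => //; rewrite -(@ltr_sqrt _ _ e).
- have [|y Dy xy] := dD x (e ^+ 2); first by rewrite exprn_gt0.
  exists y => //; rewrite /hnorm -(ger0_norm (ltW e0)) -sqrtr_sqr.
  by rewrite ltr_sqrt// exprn_gt0.
Qed.

Lemma hdense_approx H (D D' : set H) : hdense D ->
  (forall x (e : R), D x -> 0 < e -> exists2 y, D' y & sqnorm (x - y) < e) ->
  hdense D'.
Proof.
move=> /hdenseP dD DD'; apply/hdenseP => x e e0.
have e4 : 0 < e / 4 by rewrite divr_gt0.
have [y Dy xy] := dD x _ e4; have [z Dz yz] := DD' y _ Dy e4.
exists z => //; rewrite -(subrK y x) -addrA.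
apply: le_lt_trans (sqnormD_le _ _) _; lra.
Qed.

Lemma hdense_sub H (D D' : set H) : D `<=` D' -> hdense D -> hdense D'.
Proof.
move=> DD' dD; apply: hdense_approx dD _ => x e Dx e0.
by exists x; [exact: DD'|rewrite subrr /sqnorm dotp0l].
Qed.

(** The real and imaginary parts of [dotp x y] are read off [a = 1] and [a = 'i],
    and [a = 0] gives the norm of [y]. *)
Lemma polarization H K (x y : H) (x' y' : K) : sqnorm x = sqnorm x' ->
  (forall a : R[i], sqnorm (a *: x + y) = sqnorm (a *: x' + y')) ->
  dotp x y = dotp x' y'.
Proof.
move=> xx' E; have := E 1; have := E 0; have := E 'i.
rewrite !scale0r !add0r !scale1r !sqnormD !sqnormZ xx' => h1 h2.
rewrite h2 in h1 *; move: h1; rewrite !dotpZl.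
case: (dotp x y) (dotp x' y') => [a b] [s t] /= h1 h3.
by apply/eqP; rewrite eq_complex /=; apply/andP; split; apply/eqP; lra.
Qed.

Lemma selfadjointE H (A : operator H H) x y : positive_selfadjoint A ->
  A (x, y) <-> forall u v, A (u, v) -> dotp v x = dotp u y.
Proof. by move=> [_ E _]; rewrite -{1}E. Qed.

Lemma selfadjoint_lin H (A : operator H H) (a : R[i]) x y u v :
  positive_selfadjoint A -> A (x, y) -> A (u, v) ->
  A (a *: x + u, a *: y + v).
Proof.
move=> sA xy uv; apply/selfadjointE => // s t st.
by rewrite !dotpDr !dotpZr ((selfadjointE _ _ sA).1 xy _ _ st)
  ((selfadjointE _ _ sA).1 uv _ _ st).
Qed.

Lemma sqnorm_monotone H (a : R) (x y : H) : 0 <= a -> 0 <= Re (dotp y x) ->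
  sqnorm x + a ^+ 2 * sqnorm y <= sqnorm (a%:C *: y + x).
Proof.
move=> a0 yx; rewrite sqnormD sqnormZ dotpZl.
have -> : Re (a%:C * dotp y x) = a * Re (dotp y x).
  by case: (dotp y x) => s t /=; rewrite mul0r subr0.
have -> : normc a%:C = a.
  by rewrite /= expr0n addr0 sqrtr_sqr ger0_norm.
by have := mulr_ge0 a0 yx; lra.
Qed.

(** On the core [D] the positive operator [A] is a square root of [B^2], where [B]
    is symmetric and [s] is so small that [1 - s B] is a contraction.  The
    difference [X := A - B] satisfies [A X = - X B], hence
    [(1 + s A)^k X f = X (1 - s B)^k f], and the right-hand side stays bounded as
    [k] grows.  As [A] is positive, [|(1 + s A)^k w|^2 >= |w|^2 + k s^2 |A w|^2],
    which forces [A X f = 0].  So [X f] lies in the kernel of [A]; it is also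
    orthogonal to it, since the ranges of both [A] and [B] are, and therefore
    vanishes. *)
Lemma positive_sqrt_unique H (A : operator H H) (D : set H) (B : H -> H)
    (s K : R) : positive_selfadjoint A -> 0 < s -> 0 <= K ->
  (forall a f g, D f -> D g -> D (a *: f + g)) ->
  (forall f, D f -> D (B f)) ->
  (forall a f g, D f -> D g -> B (a *: f + g) = a *: B f + B g) ->
  (forall f g, D f -> D g -> dotp (B f) g = dotp f (B g)) ->
  (forall f, D f -> sqnorm (B f) <= K * sqnorm f) ->
  (forall f, D f -> sqnorm (- s%:C *: B f + f) <= sqnorm f) ->
  (forall f, D f -> comp_op A A (f, B (B f))) ->
  (forall f z, D f -> A (z, 0) -> dotp (B f) z = 0) ->
  forall f, D f -> A (f, B f).
Proof.
move=> sA s0 K0 Dlin BD Blin Bsym Bbnd Bcontr A2 Bker.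
have Alin a x y u v := @selfadjoint_lin _ A a x y u v sA.
have Apos x y : A (x, y) -> 0 <= Re (dotp y x).
  by case: sA => _ _ /[apply]; case: (dotp _ _) => a b; rewrite lecE => /andP[].
(* [X f w] says that [w = (A - B) f], together with [A (A f) = B (B f)]. *)
pose X f w := [/\ D f, A (f, w + B f) & A (w + B f, B (B f))].
have Xlin a f w g v : X f w -> X g v -> X (a *: f + g) (a *: w + v).
  move=> [Df f1 f2] [Dg g1 g2]; split; first exact: Dlin.
  - by rewrite Blin// addrACA -scalerDr; exact: Alin.
  - rewrite !Blin//; [|exact: BD|exact: BD].
    by rewrite addrACA -scalerDr; exact: Alin.
have XB f w : X f w -> exists2 w', A (w, w') & X (B f) (- w').
  move=> [Df f1 f2]; have DBf := BD _ Df.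
  have [u u1 u2] := A2 _ DBf.
  exists (B (B f) - u).
    have := Alin (-1) _ _ _ _ u1 f2.
    by rewrite !scaleN1r (addrC (- B f)) addrK (addrC (- u)).
  by rewrite opprB; split; rewrite ?subrK.
have Xbnd f w : X f w -> sqnorm w <= 4 * K * sqnorm f.
  move=> [Df f1 f2]; rewrite -(addrK (B f) w).
  apply: le_trans (sqnormD_le _ _) _; rewrite sqnormN.
  have -> : sqnorm (w + B f) = sqnorm (B f).
    rewrite /sqnorm ((selfadjointE _ _ sA).1 f2 _ _ f1) -Bsym//; exact: BD.
  by have := Bbnd _ Df; lra.
(* Induction on [k]: replace [f] by [f - s B f] and [w] by [w + s A w]. *)
have key k : forall f w w', X f w -> A (w, w') -> X (B f) (- w') ->
    sqnorm w + s ^+ 2 * sqnorm w' *+ k <= 4 * K * sqnorm f.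
  elim: k => [|k IH] f w w' Xf ww' XBf; first by rewrite mulr0n addr0 Xbnd.
  have Df : D f by case: Xf.
  have [v' v1 v2] := XB _ _ XBf.
  have X1 := Xlin (- s%:C) _ _ _ _ XBf Xf.
  have A1 := Alin (- s%:C) _ _ _ _ v1 ww'.
  have X2 : X (B (- s%:C *: B f + f)) (- (- s%:C *: v' + w')).
    rewrite Blin//; last exact: BD.
    by have := Xlin (- s%:C) _ _ _ _ v2 XBf; rewrite scalerN opprD.
  have := IH _ _ _ X1 A1 X2.
  have h0 := Bcontr _ Df.
  have h1 := sqnorm_monotone (ltW s0) (Apos _ _ ww').
  have h2 : sqnorm w' <= sqnorm (- s%:C *: v' + w').
    have := sqnorm_monotone (ltW s0) (Apos _ _ v1).
    have -> : sqnorm (- s%:C *: v' + w') = sqnorm (s%:C *: v' - w').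
      by rewrite -sqnormN opprD scaleNr opprK.
    by rewrite sqnormN; apply: le_trans; rewrite lerDl mulr_ge0 ?sqnorm_ge0 ?sqr_ge0.
  have h3 : s ^+ 2 * sqnorm w' *+ k <= s ^+ 2 * sqnorm (- s%:C *: v' + w') *+ k.
    by rewrite lerMn2r ler_wpM2l ?sqr_ge0 ?orbT.
  have h4 : 4 * K * sqnorm (- s%:C *: B f + f) <= 4 * K * sqnorm f.
    by rewrite ler_wpM2l// mulr_ge0.
  by rewrite mulrS scalerN scaleNr opprK => h5; lra.
move=> f Df; have [u u1 u2] := A2 _ Df.
have Xf : X f (u - B f) by split; rewrite ?subrK.
have [w' ww' XBf] := XB _ _ Xf.
have w'0 : w' = 0.
  apply: sqnorm_eq0; apply/eqP; rewrite eq_le sqnorm_ge0 andbT.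
  rewrite leNgt; apply/negP => w'0.
  have p : 0 < s ^+ 2 * sqnorm w' by rewrite mulr_gt0 ?exprn_gt0.
  have := archi_boundP (divr_ge0 (mulr_ge0 (mulr_ge0 (ler0n R 4) K0)
    (sqnorm_ge0 f)) (ltW p)).
  rewrite ltr_pdivrMr// [X in _ < X]mulr_natl ltNge => /negP; apply.
  apply: le_trans (key _ _ _ _ Xf ww' XBf); apply: ler_wpDl => //; exact: sqnorm_ge0.
have : sqnorm (u - B f) = 0.
  rewrite /sqnorm dotpDl dotpNl (Bker f)//; last by rewrite -w'0.
  by rewrite ((selfadjointE _ _ sA).1 ww' _ _ u1) w'0 dotp0r subrr.
by move=> /sqnorm_eq0/subr0_eq <-.
Qed.

End InnerProductSpaces.

(** * Square-integrable functions and multipliers *)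

Section L2Functions.
Context d (X : measurableType d) (R : realType).
Variable mu : {measure set X -> \bar R}.
Implicit Types (F G : X -> R[i]) (f g : L2 mu) (m : X -> R).

Definition sqmod F : X -> \bar R := fun x => ((normc (F x)) ^+ 2)%:E.

Lemma sqr_normc (z : R[i]) : normc z ^+ 2 = Re z ^+ 2 + Im z ^+ 2.
Proof. by case: z => a b; rewrite /= sqr_sqrtr// addr_ge0 ?sqr_ge0. Qed.

Lemma normc_ge0 (z : R[i]) : 0 <= normc z.
Proof. by case: z => a b; exact: sqrtr_ge0. Qed.

Lemma normc_real (a : R) : normc a%:C = `|a|.
Proof. by rewrite /= expr0n addr0 sqrtr_sqr. Qed.

Lemma sqmod_ge0 F x : (0 <= sqmod F x)%E.
Proof. by rewrite lee_fin sqr_ge0. Qed.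

Lemma measurable_sqmod F : cmeasurable F -> measurable_fun setT (sqmod F).
Proof.
move=> [Fr Fi]; apply/measurable_EFinP.
rewrite (_ : (fun _ => _) = (fun x => (Re (F x)) ^+ 2) \+ (fun x => (Im (F x)) ^+ 2)).
  by apply: measurable_funD; exact: measurable_funX.
by apply/funext => x; rewrite sqr_normc.
Qed.

Lemma cmeasurable_L2 f : cmeasurable f.
Proof. by have := L2_sqint f; rewrite inE => -[]. Qed.

Lemma cmeasurable_real m : measurable_fun setT m ->
  cmeasurable (fun x => (m x)%:C).
Proof. by move=> mm; split => //=; exact: measurable_cst. Qed.

Lemma cmeasurableM F G : cmeasurable F -> cmeasurable G ->
  cmeasurable (fun x => F x * G x).
Proof.
move=> [Fr Fi] [Gr Gi]; split.
- rewrite (_ : (fun _ => _) =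
    ((fun x => Re (F x)) \* (fun x => Re (G x))) \-
    ((fun x => Im (F x)) \* (fun x => Im (G x)))).
    by apply: measurable_funB; exact: measurable_funM.
  by apply/funext => x /=; case: (F x) (G x) => [a b] [s t].
- rewrite (_ : (fun _ => _) =
    ((fun x => Re (F x)) \* (fun x => Im (G x))) \+
    ((fun x => Im (F x)) \* (fun x => Re (G x)))).
    by apply: measurable_funD; exact: measurable_funM.
  by apply/funext => x /=; case: (F x) (G x) => [a b] [s t].
Qed.

Lemma cmeasurable_comp F (phi : X -> X) : measurable_fun setT phi ->
  cmeasurable F -> cmeasurable (F \o phi).
Proof.
by move=> mphi [Fr Fi]; split; [exact: (measurableT_comp Fr mphi)|
  exact: (measurableT_comp Fi mphi)].
Qed.

Lemma cmeasurableB F G : cmeasurable F -> cmeasurable G ->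
  cmeasurable (fun x => F x - G x).
Proof.
move=> [Fr Fi] [Gr Gi]; split.
- rewrite (_ : (fun _ => _) = (fun x => Re (F x)) \- (fun x => Re (G x))).
    exact: measurable_funB.
  by apply/funext => x; rewrite raddfB.
- rewrite (_ : (fun _ => _) = (fun x => Im (F x)) \- (fun x => Im (G x))).
    exact: measurable_funB.
  by apply/funext => x; rewrite raddfB.
Qed.

Lemma sqint_le F G (c : R) : 0 <= c -> cmeasurable F -> G \in sqint mu ->
  (\forall x \ae mu, normc (F x) <= c * normc (G x)) -> F \in sqint mu.
Proof.
move=> c0 mF; rewrite !inE => -[mG iG] FG; split => //.
have mG2 := measurable_sqmod mG.
apply: (@le_lt_trans _ _ (\int[mu]_x ((c ^+ 2)%:E * sqmod G x))%E); last first.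
  rewrite ge0_integralZl_EFin ?sqr_ge0//; last by move=> x _; exact: sqmod_ge0.
  by rewrite lte_mul_pinfty ?lee_fin ?sqr_ge0.
apply: ae_ge0_le_integral => //.
- by move=> x _; exact: sqmod_ge0.
- exact: measurable_sqmod.
- by move=> x _; rewrite mule_ge0 ?sqmod_ge0// lee_fin sqr_ge0.
- exact: measurable_funeM.
- apply: filterS FG => x h _; rewrite /sqmod -EFinM lee_fin -exprMn.
  by rewrite lerXn2r ?nnegrE ?normc_ge0// mulr_ge0 ?normc_ge0.
Qed.

Lemma integral_sqmod_ae F G : cmeasurable F -> cmeasurable G ->
  (\forall x \ae mu, F x = G x) -> (\int[mu]_x sqmod F x = \int[mu]_x sqmod G x)%E.
Proof.
move=> mF mG FG; apply: ge0_ae_eq_integral => //.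
- exact: measurable_sqmod.
- exact: measurable_sqmod.
- by move=> x _; exact: sqmod_ge0.
- by move=> x _; exact: sqmod_ge0.
- by apply: filterS FG => x FG _; rewrite /sqmod FG.
Qed.

Lemma L2_sqnorm f : (sqnorm f)%:E = (\int[mu]_x sqmod f x)%E.
Proof.
have [fr _] := L2_dot_integrable f f.
have E x : (Re (f x * (f x)^*))%:E = sqmod f x.
  by rewrite /sqmod sqr_normc; case: (f x) => a b /=; rewrite mulrN opprK.
rewrite /sqnorm -[dotp f f]/(L2_dot f f) /L2_dot /cintegral /= /Rintegral.
rewrite fineK; last exact: (integrable_fin_num measurableT fr).
by apply: eq_integral => x _; rewrite -E.
Qed.

(** Functions outside [L^2] are sent to [0], which makes multiplication by an
    unbounded function total. *)
Definition L2_of F : L2 mu :=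
  if boolP (F \in sqint mu) is AltTrue p then L2_class (MkL2fun p) else 0.

Lemma L2_ofE F : F \in sqint mu -> \forall x \ae mu, L2_of F x = F x.
Proof.
move=> FP; rewrite /L2_of; case: {-}_ / boolP; last by rewrite FP.
by move=> p; exact: L2_classE.
Qed.

Lemma L2_of_sqnorm F : F \in sqint mu ->
  (sqnorm (L2_of F))%:E = (\int[mu]_x sqmod F x)%E.
Proof.
move=> FP; rewrite L2_sqnorm; apply: integral_sqmod_ae.
- exact: cmeasurable_L2.
- by move: FP; rewrite inE => -[].
- exact: L2_ofE.
Qed.

Lemma L2_subE f g : \forall x \ae mu, (f - g : L2 mu) x = f x - g x.
Proof.
have := L2_linE (-1) g f; apply: filterS => x.
by rewrite scaleN1r mulN1r addrC => ->; rewrite addrC.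
Qed.

Lemma L2_0E : \forall x \ae mu, (0 : L2 mu) x = 0.
Proof. by have := L2_subE 0 0; apply: filterS => x; rewrite !subrr. Qed.

Lemma L2_scaleE (a : R[i]) f : \forall x \ae mu, (a *: f : L2 mu) x = a * f x.
Proof.
have := L2_linE a f 0; apply: filterS2 L2_0E => x -> /=.
by rewrite !addr0.
Qed.

Lemma L2_dot_ae f g f' g' :
  (\forall x \ae mu, f x * (g x)^* = f' x * (g' x)^*) ->
  dotp f g = dotp f' g'.
Proof.
move=> E; have I := L2_dot_integrable f g; have I' := L2_dot_integrable f' g'.
rewrite -[LHS]/(L2_dot f g) -[RHS]/(L2_dot f' g').
have Z := L2_dot_integrable 0 (0 : L2 mu).
have := @cintegral_linear _ _ _ mu 0 _ _ _ I Z I'; rewrite mul0r add0r; apply.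
by apply: filterS E => x ->; rewrite mul0r add0r.
Qed.

Definition mulL2 m f : L2 mu := L2_of (fun x => (m x)%:C * f x).

Lemma cmeasurable_mul m f : measurable_fun setT m ->
  cmeasurable (fun x => (m x)%:C * f x).
Proof.
by move=> mm; apply: cmeasurableM; [exact: cmeasurable_real|exact: cmeasurable_L2].
Qed.

Lemma sqint_mul_bounded m f (c : R) : 0 <= c -> measurable_fun setT m ->
  (forall x, `|m x| <= c) -> (fun x => (m x)%:C * f x) \in sqint mu.
Proof.
move=> c0 mm mc; apply: (sqint_le c0 _ (L2_sqint f)); first exact: cmeasurable_mul.
by apply: aeW => x; rewrite normcM normc_real ler_wpM2r ?normc_ge0.
Qed.

Lemma indic_le1 (S : set X) x : `|\1_S x : R| <= 1.
Proof. by rewrite indicE; case: (x \in S); rewrite ?normr1 ?normr0. Qed.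

Lemma restrE (S : set X) f : measurable S ->
  \forall x \ae mu, mulL2 \1_S f x = (\1_S x)%:C * f x.
Proof.
move=> mS; apply: L2_ofE; apply: (@sqint_mul_bounded _ _ 1) => //.
exact: indic_le1.
Qed.

Definition sublevel m (n : nat) : set X := [set x | m x <= n.+1%:R].

Lemma measurable_sublevel m n : measurable_fun setT m -> measurable (sublevel m n).
Proof.
move=> mm; rewrite (_ : sublevel m n = m @^-1` [set` `]-oo, n.+1%:R]]).
  by rewrite -[_ @^-1` _]setTI; exact: mm.
by apply/seteqP; split=> x; rewrite /sublevel /= in_itv.
Qed.

(** The sets where [m <= n + 1] exhaust the space, so dominated convergence
    applies.  Used for [m] and, with [1 / 0 = 0], for [1 / m]. *)
Lemma sublevel_tail m f (e : R) : measurable_fun setT m -> 0 < e ->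
  exists n, sqnorm (f - mulL2 \1_(sublevel m n) f) < e.
Proof.
move=> mm e0; pose S := sublevel m.
have mS n : measurable (S n) by exact: measurable_sublevel.
have Sx x : exists n0, forall n, (n0 <= n)%N -> S n x.
  exists (Num.truncn (m x)) => n xn; rewrite /S /sublevel /=.
  by apply/ltW/(lt_le_trans (truncnS_gt _)); rewrite ler_nat.
pose F n x := (\1_(~` S n) x)%:C * f x.
have mCS n : measurable_fun setT (\1_(~` S n) : X -> R).
  by apply: measurable_indic; exact: measurableC.
have E n : (sqnorm (f - mulL2 \1_(S n) f))%:E = (\int[mu]_x sqmod (F n) x)%E.
  rewrite L2_sqnorm; apply: integral_sqmod_ae; first exact: cmeasurable_L2.
    exact: cmeasurable_mul.
  apply: filterS2 (L2_subE f (mulL2 \1_(S n) f)) (restrE f (mS n)) => x -> ->.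
  rewrite /F !indicE in_setC; case: (x \in S n) => /=.
  - by rewrite mul1r mul0r subrr.
  - by rewrite mul0r mul1r subr0.
have cv : (\int[mu]_x sqmod (F n) x @[n --> \oo] --> \int[mu]_x (cst 0 x : \bar R))%E.
  apply: (@dominated_cvg _ _ _ mu setT measurableT _ _ (sqmod f)) => //.
  - by move=> n; apply: measurable_sqmod; exact: cmeasurable_mul.
  - move=> x _; have [n0 n0P] := Sx x.
    apply: cvg_near_cst; exists n0 => // n /= /n0P Snx.
    rewrite /sqmod /F indicE in_setC mem_set//.
    by rewrite [(~~ true)%:R]/= mul0r normc0 expr0n.
  - apply/integrableP; split; first by apply: measurable_sqmod; exact: cmeasurable_L2.
    under eq_integral do rewrite gee0_abs ?sqmod_ge0//.
    by rewrite -L2_sqnorm ltry.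
  - move=> n x _; rewrite gee0_abs ?sqmod_ge0// /sqmod lee_fin.
    rewrite lerXn2r ?nnegrE ?normc_ge0//.
    by rewrite normcM normc_real ler_piMl ?normc_ge0// indic_le1.
rewrite integral0 in cv.
have : \forall n \near \oo, (\int[mu]_x sqmod (F n) x < e%:E)%E.
  apply: (cv [set y | (y < e%:E)%E]).
  exact: (@nbhs_open_ereal_lt _ 0 (fun=> e)).
by move=> [n _ /(_ n (leqnn n))] /=; rewrite -E lte_fin; exists n.
Qed.

End L2Functions.

(** * Push-forward of a finite density *)

Section DensityMeasure.
Local Open Scope ereal_scope.
Context d (X : measurableType d) (R : realType).
Variable mu : {measure set X -> \bar R}.
Variables (phi : X -> X) (F : X -> \bar R).

(** The hypotheses are arguments so that the measure structure can be inferred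
    from the term. *)
Definition push_density of measurable_fun setT phi & measurable_fun setT F &
    (forall x, 0 <= F x) & \int[mu]_x F x < +oo :=
  fun A => \int[mu]_(x in phi @^-1` A) F x.

Hypotheses (mphi : measurable_fun setT phi) (mF : measurable_fun setT F).
Hypotheses (F0 : forall x, 0 <= F x) (iF : \int[mu]_x F x < +oo).

Local Notation nu := (push_density mphi mF F0 iF).

Let mpre A : measurable A -> measurable (phi @^-1` A).
Proof. by move=> mA; rewrite -[_ @^-1` _]setTI; exact: mphi. Qed.

Let nu0 : nu set0 = 0.
Proof. by rewrite /push_density preimage_set0 integral_set0. Qed.

Let nu_ge0 A : 0 <= nu A.
Proof. by apply: integral_ge0 => x _; exact: F0. Qed.

Let nu_additive : semi_sigma_additive nu.
Proof.
move=> A mA tA mUA; rewrite /push_density preimage_bigcup.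
rewrite ge0_integral_bigcup//.
- apply: is_cvg_ereal_nneg_natsum_cond => n _ _.
  by apply: integral_ge0 => x _; exact: F0.
- by move=> k; exact: mpre.
- exact: measurable_funTS.
- apply/trivIsetP => /= i j _ _ ij; rewrite -preimage_setI.
  by move/trivIsetP : tA => /(_ _ _ _ _ ij) ->//; rewrite preimage_set0.
Qed.

HB.instance Definition _ := isMeasure.Build _ _ _ nu nu0 nu_ge0 nu_additive.

Let nu_fin : fin_num_fun nu.
Proof.
move=> A mA; rewrite ge0_fin_numE//; apply: le_lt_trans iF.
by apply: ge0_subset_integral => //; exact: mpre.
Qed.

HB.instance Definition _ := @Measure_isFinite.Build _ _ _ nu nu_fin.

End DensityMeasure.

Section PushDensity.
Local Open Scope ereal_scope.
Context d (X : measurableType d) (R : realType).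
Variable mu : {sigma_finite_measure set X -> \bar R}.

Let density_integral (F g : X -> \bar R) (mF : measurable_fun setT F)
    (F0 : forall x, 0 <= F x) (iF : \int[mu]_x F x < +oo) :
  measurable_fun setT g -> (forall x, 0 <= g x) ->
  \int[push_density (@measurable_id _ X setT) mF F0 iF]_x g x =
  \int[mu]_x (g x * F x).
Proof.
move=> mg g0; 
pose nu : {finite_measure set X -> \bar R} :=
  push_density (@measurable_id _ X setT) mF F0 iF.
rewrite -[LHS]/(\int[nu]_x g x).
have nu_mu : nu `<< mu.
  apply/null_content_dominatesP => N mN N0.
  rewrite -[LHS]/(\int[mu]_(x in N) F x).
  by apply: null_set_integral => //; exact: measurable_funTS.
rewrite -(Radon_Nikodym_SigmaFinite.change_of_variables nu_mu)//.
have iRN := Radon_Nikodym_SigmaFinite.f_integrable nu_mu.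
have mRN := measurable_int _ iRN.
have RN0 := Radon_Nikodym_SigmaFinite.f_ge0 nu_mu.
apply: ge0_ae_eq_integral => //.
- exact: emeasurable_funM.
- exact: emeasurable_funM.
- by move=> x _; rewrite mule_ge0.
- by move=> x _; rewrite mule_ge0.
have : ae_eq mu setT (Radon_Nikodym_SigmaFinite.f nu mu) F.
  apply: integral_ae_eq => // E _ mE.
  by rewrite -Radon_Nikodym_SigmaFinite.f_integral.
by apply: filterS => x /= + _ => /(_ I) ->.
Qed.

(** Change of variables for the finite measure of density [F]: first along [phi], then
    for the Radon-Nikodym derivative of its image. *)
Lemma push_density_RN (phi : X -> X) (F : X -> \bar R) :
  measurable_fun setT phi -> measurable_fun setT F ->
  (forall x, 0 <= F x) -> \int[mu]_x F x < +oo ->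
  (forall N, measurable N -> mu N = 0 -> \int[mu]_(x in phi @^-1` N) F x = 0) ->
  exists p : X -> \bar R, [/\ forall x, 0 <= p x, forall x, p x \is a fin_num,
    measurable_fun setT p &
    forall g, measurable_fun setT g -> (forall x, 0 <= g x) ->
      \int[mu]_x (F x * g (phi x)) = \int[mu]_x (p x * g x)].
Proof.
move=> mphi mF F0 iF ac.
pose nu : {finite_measure set X -> \bar R} := push_density mphi mF F0 iF.
have nu_mu : nu `<< mu by exact/null_content_dominatesP.
exists (Radon_Nikodym_SigmaFinite.f nu mu); split.
- exact: Radon_Nikodym_SigmaFinite.f_ge0.
- exact: Radon_Nikodym_SigmaFinite.f_fin_num.
- exact: measurable_int (Radon_Nikodym_SigmaFinite.f_integrable nu_mu).
move=> g mg g0; under [RHS]eq_integral do rewrite muleC.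
rewrite Radon_Nikodym_SigmaFinite.change_of_variables//.
under [LHS]eq_integral do rewrite muleC.
rewrite -(density_integral mF F0 iF)//; last exact: measurableT_comp.
rewrite -[LHS](@ge0_integral_pushforward _ _ _ _ _ _ mphi _ setT g)//.
Qed.

End PushDensity.

(** * The density attached to a weighted composition operator *)

Lemma measurable_invr d (X : measurableType d) (R : realType) (G : X -> R) :
  (forall x, 0 <= G x) -> measurable_fun setT G ->
  measurable_fun setT (fun x => (G x)^-1).
Proof.
move=> G0 mG; rewrite (_ : (fun _ => _) = (fun x => powR x (-1)) \o G).
  by apply: measurableT_comp => //; exact: measurable_powR.
by apply/funext => x /=; rewrite powR_inv1.
Qed.

(** [phi^-1] of a null set is null for the measure of density [|w|^2], that is, null
    up to points where [w] vanishes. *)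
Lemma wcomp_ae_pull d (X : measurableType d) (R : realType)
    (mu : {measure set X -> \bar R}) (phi : X -> X) (w : X -> R[i])
    (symb : wcomp_symbol mu phi w) (P : X -> Prop) : (\forall x \ae mu, P x) ->
  \forall x \ae mu, P (phi x) \/ w x = 0.
Proof.
move=> aeP; pose F x : R[i] := if pselect (P x) then 1 else 0.
have FP : \forall x \ae mu, F x = 1.
  by apply: filterS aeP => x; rewrite /F; case: pselect.
have := wcomp_ae symb FP; apply: filterS => x.
rewrite /F mulr1; case: pselect => [Pf _|nPf /=]; first by left.
by rewrite mulr0 => <-; right.
Qed.

Section WeightDensity.
Context d (X : measurableType d) (R : realType).

Definition weight_density (mu : {measure set X -> \bar R}) (phi : X -> X)
    (w : X -> R[i]) (h : X -> R) : Prop :=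
  [/\ forall x, 0 <= h x, measurable_fun setT h &
    forall g : X -> \bar R, measurable_fun setT g -> (forall x, (0 <= g x)%E) ->
      (\int[mu]_x (sqmod w x * g (phi x)) = \int[mu]_x ((h x)%:E * g x))%E].

Variable mu : {sigma_finite_measure set X -> \bar R}.
Variables (phi : X -> X) (w : X -> R[i]).
Hypotheses (symb : wcomp_symbol mu phi w).
Let C := wcomp_op mu phi w.
Hypothesis dC : hdense (opdom C).

Let mphi : measurable_fun setT phi. Proof. by case: symb. Qed.
Let mw : cmeasurable w. Proof. by case: symb. Qed.
Let mpre N : measurable N -> measurable (phi @^-1` N).
Proof. by move=> mN; rewrite -[_ @^-1` _]setTI; exact: mphi. Qed.

(** Approximate the indicators of an increasing exhaustion [F n] of finite measure
    by [f_ n] in the domain, within [1 / (n + 1)].  The common zero set [N] of the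
    [f_ n] satisfies [mu (N `&` F k) <= sqnorm (1_(F n) - f_ n)] for [n >= k], so it is
    null. *)
Lemma cover_by_domain : exists f_ : nat -> L2 mu, (forall n, opdom C (f_ n)) /\
  \forall x \ae mu, exists n, (f_ n : L2 mu) x != 0.
Proof.
have [F [UF ndF /all_and2[mF Foo]]] := (sigma_finiteP setT mu).1 (sigma_finiteT mu).
have Fsq n : (fun x => (\1_(F n) x)%:C : R[i]) \in sqint mu.
  rewrite inE; split; first exact/cmeasurable_real/measurable_indic.
  rewrite (_ : (fun _ => _) = (EFin \o \1_(F n))).
    by rewrite integral_indic// setIT; exact: Foo.
  apply/funext => x /=; rewrite expr0n addr0 sqrtr_sqr indicE.
  by case: (x \in F n); rewrite ?normr1 ?normr0 ?expr1n ?expr0n.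
have /choice[f_ f_P] : forall n, exists f : L2 mu, opdom C f /\
    sqnorm (L2_of mu (fun x => (\1_(F n) x)%:C) - f) < n.+1%:R^-1.
  move=> n; have [|f Df fn] := (hdenseP _).1 dC (L2_of mu (fun x => (\1_(F n) x)%:C))
    n.+1%:R^-1; first by rewrite invr_gt0.
  by exists f.
exists f_; split; first by move=> n; have [] := f_P n.
pose N := [set x | forall n, (f_ n : L2 mu) x = 0].
have mN : measurable N.
  rewrite (_ : N = \bigcap_n [set x | sqmod (f_ n) x = 0%E]).
    apply: bigcapT_measurable => n.
    have := measurable_sqmod (cmeasurable_L2 (f_ n)) measurableT (emeasurable_set1 0%E).
    by rewrite setTI.
  apply/seteqP; split=> [x Nx n _|x Nx n] /=.
    by rewrite /sqmod Nx normc0 expr0n.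
  have := Nx n I; rewrite /= /sqmod => -[/eqP].
  by rewrite sqrf_eq0 => /eqP/eq0_normc.
suff N0 : mu N = 0%E.
  exists N; split => // x /= Nx n; apply/eqP/negPn/negP => fx.
  by apply: Nx; exists n.
rewrite (_ : N = \bigcup_k (N `&` F k)); last by rewrite -setI_bigcupr -UF setIT.
apply/negligibleP; first by apply: bigcupT_measurable => k; exact: measurableI.
apply: negligible_bigcup => k; apply/negligibleP; first exact: measurableI.
apply/eqP; rewrite eq_le measure_ge0 andbT; apply/lee_addgt0Pr => e e0.
rewrite add0e.
have [n [kn ne]] : exists n, (k <= n)%N /\ n.+1%:R^-1 < e.
  exists (maxn k (Num.bound e^-1)); split; first exact: leq_maxl.
  rewrite invf_plt ?posrE//; apply: (lt_le_trans (archi_boundP _)).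
    by rewrite invr_ge0 ltW.
  by rewrite ler_nat leqW// leq_maxr.
apply: le_trans (_ : _ <= (n.+1%:R^-1)%:E)%E _; last by rewrite lee_fin ltW.
have [_ /ltW] := f_P n; rewrite -lee_fin L2_sqnorm; apply: le_trans.
pose G x := (\1_(F n) x)%:C - f_ n x.
have mG : cmeasurable G.
  apply: cmeasurableB; last exact: cmeasurable_L2.
  exact/cmeasurable_real/measurable_indic.
rewrite (@integral_sqmod_ae _ _ _ _ _ G)//; last 2 first.
- exact: cmeasurable_L2.
- apply: filterS2 (L2_subE (L2_of mu (fun x => (\1_(F n) x)%:C)) (f_ n))
    (L2_ofE (Fsq n)) => x -> ->.
  by [].
have mNF : measurable (N `&` F k) by exact: measurableI.
apply: (@le_trans _ _ (\int[mu]_x (\1_(N `&` F k) x)%:E)%E).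
  by rewrite integral_indic// setIT.
apply: ge0_le_integral => //.
- exact/measurable_EFinP/measurable_indic.
- exact: measurable_sqmod.
- move=> x _; rewrite indicE; case: (boolP (x \in _)); last by rewrite sqmod_ge0.
  rewrite inE => -[Nx Fx]; rewrite /sqmod /G Nx subr0 indicE mem_set.
    by rewrite normc_real normr1 expr1n.
  by move/subsetPset : (ndF _ _ kn); exact.
Qed.

Lemma wcomp_dom_lt (f : L2 mu) : opdom C f ->
  (\int[mu]_x (sqmod w x * sqmod f (phi x)) < +oo)%E.
Proof.
move=> /(wcomp_op_dom f symb); rewrite inE => -[_].
by under eq_integral do rewrite normcM exprMn EFinM.
Qed.

(** The push-forward of [|w|^2 mu] need not be finite, but it becomes so once
    multiplied by a suitable [G > 0]: a summable combination of the functions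
    [min 1 |f_n|^2], where the [f_n] lie in the domain of [C] and have no common
    zero.  Bounding [G] by [1] keeps it real-valued. *)
Lemma finite_density : exists G : X -> R, [/\ measurable_fun setT G,
  forall x, 0 <= G x <= 1, \forall x \ae mu, G x != 0 &
  (\int[mu]_x (sqmod w x * (G (phi x))%:E) < +oo)%E].
Proof.
have [f_ [Df f_n0]] := cover_by_domain.
pose I n := (\int[mu]_x (sqmod w x * sqmod (f_ n) (phi x)))%E.
have I0 n : (0 <= I n)%E by apply: integral_ge0 => x _; rewrite mule_ge0 ?sqmod_ge0.
have Ifin n : I n \is a fin_num by rewrite ge0_fin_numE// wcomp_dom_lt.
pose a n : R := 1 / (2 ^ n.+1)%:R.
have a0 n : 0 < a n by rewrite divr_gt0// ltr0n expn_gt0.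
(* The factor [1 / (1 + I n)] bounds the n-th integral by [a n], and [a n] is the
   general term of a series of sum 1. *)
pose c n : R := a n / (1 + fine (I n)).
have I1 n : 0 < 1 + fine (I n) by rewrite ltr_wpDr// fine_ge0.
have c0 n : 0 < c n by rewrite divr_gt0.
pose t n x : R := c n * Num.min 1 (normc (f_ n x) ^+ 2).
have min0 n x : 0 <= Num.min 1 (normc (f_ n x) ^+ 2).
  by rewrite le_min ler01 sqr_ge0.
have t0 n x : 0 <= t n x by rewrite mulr_ge0// ltW.
have mt n : measurable_fun setT (t n).
  apply: measurable_funM => //; apply: measurable_minr => //.
  by apply/measurable_EFinP/measurable_sqmod/cmeasurable_L2.
have t1 n x : t n x <= a n.
  rewrite /t /c -mulrA ler_piMr ?(ltW (a0 n))//.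
  rewrite mulrC ler_pdivrMr// mul1r; apply: le_trans (_ : _ <= 1) _.
    by rewrite ge_min lexx.
  by rewrite lerDl fine_ge0.
pose g x : \bar R := (\sum_(n <oo) (t n x)%:E)%E.
have g0 x : (0 <= g x)%E by apply: nneseries_ge0 => n _ _; rewrite lee_fin.
have g1 x : (g x <= 1)%E.
  apply: le_trans (epsilon_trick0 xpredT (@ler01 R)).
  by apply: lee_nneseries => n _; rewrite lee_fin.
have gE x : (fine (g x))%:E = g x.
  by rewrite fineK// ge0_fin_numE// (le_lt_trans (g1 x))// ltry.
have mg : measurable_fun setT g.
  apply: ge0_emeasurable_sum => [n x _ _|n _]; first by rewrite lee_fin.
  exact/measurable_EFinP.
have mwsq := measurable_sqmod mw.
have mtp n : measurable_fun setT (fun x => (t n (phi x))%:E).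
  by apply/measurable_EFinP; exact: (measurableT_comp (mt n) mphi).
exists (fine \o g); split.
- exact: measurableT_comp.
- by move=> x /=; rewrite fine_ge0//= -lee_fin gE.
- apply: filterS f_n0 => x [n fnx]; apply/negP => /eqP gx0.
  have : ((t n x)%:E <= g x)%E.
    rewrite /g (nneseriesD1 (n := n))//; last by move=> k _; rewrite lee_fin.
    by rewrite leeDl// nneseries_ge0// => k _ _; rewrite lee_fin.
  rewrite -gE -[fine (g x)]/((fine \o g) x) gx0 lee_fin leNgt => /negP; apply.
  rewrite /t mulr_gt0// lt_min ltr01/= exprn_gt0// lt_def normc_ge0 andbT.
  by apply: contra fnx => /eqP/eq0_normc ->.
- under eq_integral => x _.
    rewrite /= gE /g -nneseriesZl; last by move=> n _; rewrite lee_fin.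
    over.
  rewrite integral_nneseries//; last 2 first.
  + by move=> n; exact: emeasurable_funM.
  + by move=> n x _; rewrite mule_ge0 ?sqmod_ge0// lee_fin.
  apply: (@le_lt_trans _ _ 1%E); last by rewrite ltry.
  apply: le_trans (epsilon_trick0 xpredT (@ler01 R)).
  apply: lee_nneseries => [n _ _|n _].
    by apply: integral_ge0 => x _; rewrite mule_ge0 ?sqmod_ge0// lee_fin.
  apply: (@le_trans _ _ (\int[mu]_x ((c n)%:E * (sqmod w x * sqmod (f_ n) (phi x))))%E).
    apply: ge0_le_integral => //.
    + by move=> x _; rewrite mule_ge0 ?sqmod_ge0// lee_fin.
    + exact: emeasurable_funM.
    + apply: measurable_funeM; apply: emeasurable_funM => //.
      by apply: (measurableT_comp _ mphi); exact/measurable_sqmod/cmeasurable_L2.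
    + move=> x _; rewrite muleCA lee_wpmul2l ?sqmod_ge0//.
      by rewrite /sqmod -EFinM lee_fin /t ler_wpM2l ?(ltW (c0 n))// ge_min lexx orbT.
  rewrite ge0_integralZl_EFin ?(ltW (c0 n))//; last 2 first.
  + by move=> x _; rewrite mule_ge0 ?sqmod_ge0.
  + apply: emeasurable_funM => //.
    by apply: (measurableT_comp _ mphi); exact/measurable_sqmod/cmeasurable_L2.
  rewrite -/(I n) -(fineK (Ifin n)) -EFinM lee_fin /c -mulrA ler_piMr ?(ltW (a0 n))//.
  by rewrite mulrC ler_pdivrMr// mul1r lerDr.
Qed.

(** With [G] as in [finite_density] and [p] the density of the push-forward of
    [|w|^2 (G o phi) mu], the density sought is [p / G]. *)
Lemma weight_density_exists : exists h, weight_density mu phi w h.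
Proof.
have [G [mG G01 Gn0 iG]] := finite_density.
have G0 x : 0 <= G x by case/andP: (G01 x).
have mwsq := measurable_sqmod mw.
pose F x := (sqmod w x * (G (phi x))%:E)%E.
have F0 x : (0 <= F x)%E by rewrite mule_ge0 ?sqmod_ge0// lee_fin.
have mF : measurable_fun setT F.
  apply: emeasurable_funM => //; apply/measurable_EFinP.
  exact: (measurableT_comp mG mphi).
have ac N : measurable N -> mu N = 0%E -> (\int[mu]_(x in phi @^-1` N) F x = 0)%E.
  move=> mN N0; apply/eqP; rewrite eq_le integral_ge0// andbT.
  have [_ _ /null_content_dominatesP /(_ _ mN N0)] := symb.
  rewrite /pushforward /weighted_measure => <-.
  apply: ge0_le_integral => //.
  - exact: mpre.
  - exact: measurable_funTS.
  - exact: measurable_funTS.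
  - move=> x _; rewrite /F -[leRHS]mule1 lee_wpmul2l ?sqmod_ge0// lee_fin.
    by case/andP: (G01 (phi x)).
have [p [p0 pfin mp pE]] := push_density_RN mphi mF F0 iG ac.
exists (fun x => fine (p x) / G x); split.
- by move=> x; rewrite divr_ge0// fine_ge0.
- apply: measurable_funM; first exact: measurableT_comp.
  exact: measurable_invr.
move=> g mg g0.
have mGV : measurable_fun setT (fun x => ((G x)^-1)%:E : \bar R).
  by apply/measurable_EFinP; exact: measurable_invr.
pose g' x := ((G x)^-1%:E * g x)%E.
have g'0 x : (0 <= g' x)%E by rewrite mule_ge0// lee_fin invr_ge0.
have mg' : measurable_fun setT g' by exact: emeasurable_funM.
transitivity (\int[mu]_x (F x * g' (phi x)))%E.
  apply: ge0_ae_eq_integral => //.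
  - by apply: emeasurable_funM => //; exact: (measurableT_comp mg mphi).
  - by apply: emeasurable_funM => //; exact: (measurableT_comp mg' mphi).
  - by move=> x _; rewrite mule_ge0 ?sqmod_ge0.
  - by move=> x _; rewrite mule_ge0.
  - apply: filterS (wcomp_ae_pull symb Gn0) => x [Gx|wx] _.
    + by rewrite /F /g' -muleA; congr (_ * _)%E; rewrite muleA -EFinM divff// mul1e.
    + by rewrite /F /sqmod wx normc0 expr0n !mul0e.
rewrite pE//; apply: eq_integral => x _.
by rewrite /g' muleA EFinM fineK.
Qed.

End WeightDensity.

(** * Polar decomposition of operators with a multiplication modulus *)

Section Polar.
Context d (X : measurableType d) (R : realType).
Variable mu : {measure set X -> \bar R}.
Implicit Types (f g : L2 mu) (m : X -> R).

Lemma bool_mul_conj (b : bool) (u : R[i]) :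
  ((b%:R : R)%:C * u) * ((b%:R : R)%:C * u)^* = u * ((b%:R : R)%:C * u)^*.
Proof.
case: u => s t; apply/eqP; rewrite eq_complex; case: b => /=.
  by apply/andP; split; apply/eqP; ring.
by apply/andP; split; apply/eqP; ring.
Qed.

Lemma sqnorm_le_ae f g (c : R) : 0 <= c ->
  (\forall x \ae mu, normc (f x) <= c * normc (g x)) ->
  sqnorm f <= c ^+ 2 * sqnorm g.
Proof.
move=> c0 fg; rewrite -lee_fin EFinM !L2_sqnorm.
rewrite -ge0_integralZl_EFin ?sqr_ge0//; last 2 first.
- by move=> x _; exact: sqmod_ge0.
- exact/measurable_sqmod/cmeasurable_L2.
apply: ae_ge0_le_integral => //.
- by move=> x _; exact: sqmod_ge0.
- exact/measurable_sqmod/cmeasurable_L2.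
- by move=> x _; rewrite mule_ge0 ?sqmod_ge0// lee_fin sqr_ge0.
- exact/measurable_funeM/measurable_sqmod/cmeasurable_L2.
- apply: filterS fg => x h _; rewrite /sqmod -EFinM lee_fin -exprMn.
  by rewrite lerXn2r ?nnegrE ?normc_ge0// mulr_ge0 ?normc_ge0.
Qed.

(** The maximal domain of the multiplication operator by [m]. *)
Definition mdom m : set (L2 mu) :=
  [set f : L2 mu | (fun x => (m x)%:C * f x) \in sqint mu].

Lemma mul_ae m f : mdom m f -> \forall x \ae mu, mulL2 m f x = (m x)%:C * f x.
Proof. exact: L2_ofE. Qed.

Lemma mul_lin m a f g : mdom m f -> mdom m g -> mdom m (a *: f + g) ->
  mulL2 m (a *: f + g) = a *: mulL2 m f + mulL2 m g.
Proof.
move=> mf mg mfg; apply/L2_eqP.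
have h1 : \forall x \ae mu,
    mulL2 m (a *: f + g) x = (m x)%:C * (a * f x + g x).
  by apply: filterS2 (L2_linE a f g) (mul_ae mfg) => x <-.
have h2 : \forall x \ae mu, (a *: mulL2 m f + mulL2 m g : L2 mu) x =
    a * ((m x)%:C * f x) + (m x)%:C * g x.
  by apply: filterS3 (L2_linE a (mulL2 m f) (mulL2 m g)) (mul_ae mf) (mul_ae mg)
    => x -> -> ->.
by apply: filterS2 h1 h2 => x -> ->; rewrite mulrDr mulrCA.
Qed.

Lemma mul_sym m f g : mdom m f -> mdom m g ->
  dotp (mulL2 m f) g = dotp f (mulL2 m g).
Proof.
move=> mf mg; apply: L2_dot_ae; apply: filterS2 (mul_ae mf) (mul_ae mg) => x -> ->.
rewrite rmorphM mulrCA mulrA; congr (_ * _ * _).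
by apply/eqP; rewrite eq_complex /= oppr0 !eqxx.
Qed.

Lemma mdom_bounded m f (c : R) : 0 <= c -> measurable_fun setT m ->
  (forall x, 0 <= m x) ->
  (\forall x \ae mu, m x <= c \/ f x = 0) -> mdom m f.
Proof.
move=> c0 mm m0 mc; apply: (sqint_le c0 _ (L2_sqint f)).
  exact: cmeasurable_mul.
apply: filterS mc => x [mx|->]; last by rewrite mulr0 normc0 mulr0.
by rewrite normcM normc_real ger0_norm// ler_wpM2r// normc_ge0.
Qed.

(** [T^* T] is multiplication by [m ^+ 2], expressed through norms; this form passes
    to columns of operators. *)
Definition norm_density (K : innerProductType R) (T : operator (L2 mu) K)
    m : Prop :=
  [/\ forall (a : R[i]) u v, T u -> T v -> T (a *: u + v),
      forall f, opdom T f <-> mdom m f &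
      forall f k, T (f, k) -> sqnorm k = sqnorm (mulL2 m f)].

Section Modulus.
Variables (K : innerProductType R) (T : operator (L2 mu) K) (m : X -> R).
Hypotheses (mm : measurable_fun setT m) (m0 : forall x, 0 <= m x).
Hypothesis Tm : norm_density T m.
Variables (U : {linear L2 mu -> K}) (A : operator (L2 mu) (L2 mu)).
Hypothesis polar : polar_decomposition T U A.

Let sA : positive_selfadjoint A. Proof. by case: polar => -[]. Qed.
Let domT f : opdom T f <-> mdom m f. Proof. by case: Tm. Qed.

(** Polarization of the equality of norms. *)
Lemma norm_density_dot f g y z : T (f, y) -> T (g, z) ->
  dotp y z = dotp (mulL2 m f) (mulL2 m g).
Proof.
case: Tm => Tlin _ Tn fy gz; apply: polarization; first exact: Tn fy.
move=> a; have h := Tlin a _ _ fy gz; rewrite (Tn _ _ h) mul_lin//;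
  apply/domT.
- by exists y.
- by exists z.
- by exists (a *: y + z).
Qed.

Let bounded_support (c : R) : set (L2 mu) :=
  [set f : L2 mu | \forall x \ae mu, m x <= c \/ f x = 0].

Let bounded_support_mdom c f : 0 <= c -> bounded_support c f -> mdom m f.
Proof. by move=> c0; exact: mdom_bounded. Qed.

(** On functions carried by a set where [m <= c], multiplication by [m] is a bounded
    positive square root of [T^* T], so [positive_sqrt_unique] applies with
    [s := 1 / c]. *)
Let modulus_bounded c f : 0 < c -> bounded_support c f -> A (f, mulL2 m f).
Proof.
move=> c0; have c0' := ltW c0.
apply: (@positive_sqrt_unique _ _ _ _ _ c^-1 (c ^+ 2)) => //.
- by rewrite invr_gt0.
- exact: sqr_ge0.
- move=> a u v uc vc; apply: filterS3 (L2_linE a u v) uc vc => x ->.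
  by move=> [mx|->]; [left|move=> [mx|->]; [left|right; rewrite mulr0 addr0]].
- move=> u uc; have := mul_ae (bounded_support_mdom c0' uc).
  by apply: filterS2 uc => x [mx|->]; [left|rewrite mulr0; right].
- move=> a u v uc vc.
  have ud := bounded_support_mdom c0' uc; have vd := bounded_support_mdom c0' vc.
  apply: mul_lin => //; apply: (bounded_support_mdom c0').
  apply: filterS3 (L2_linE a u v) uc vc => x ->.
  by move=> [mx|->]; [left|move=> [mx|->]; [left|right; rewrite mulr0 addr0]].
- by move=> u v uc vc; apply: mul_sym; exact: (bounded_support_mdom c0').
- move=> u uc; apply: sqnorm_le_ae => //.
  apply: filterS2 uc (mul_ae (bounded_support_mdom c0' uc)) => x + ->.
  move=> [mx|->]; last by rewrite mulr0 normc0 mulr0.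
  by rewrite normcM normc_real ger0_norm// ler_wpM2r// normc_ge0.
- move=> u uc; rewrite -[leRHS]mul1r -(expr1n _ 2); apply: sqnorm_le_ae => //.
  have ud := bounded_support_mdom c0' uc.
  apply: filterS3 uc (mul_ae ud) (L2_linE (- c^-1%:C) (mulL2 m u) u) => x + mx ->.
  rewrite mx mul1r => -[mxc|->]; last by rewrite !mulr0 addr0.
  rewrite mulrA -[X in _ + X]mul1r -mulrDl normcM ler_piMl ?normc_ge0//.
  rewrite -rmorphN -rmorphM -(rmorph1 (real_complex R)) -rmorphD normc_real.
  rewrite mulNr ler_norml; have : 0 <= c^-1 * m x <= 1.
    by rewrite mulr_ge0 ?invr_ge0//= mulrC ler_pdivrMr// mul1r.
  by move=> /andP[? ?]; apply/andP; split; lra.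
- move=> u uc; have ud := bounded_support_mdom c0' uc.
  case: polar => -[_ ->] _ _ _.
  have [y uy] := (domT u).2 ud; exists y => //= x w xw.
  rewrite (norm_density_dot xw uy) mul_sym//; first by apply/domT; exists w.
  apply: (bounded_support_mdom c0').
  by apply: filterS2 uc (mul_ae ud) => s [ms|->]; [left|rewrite mulr0; right].
- move=> u z uc Az; have ud := bounded_support_mdom c0' uc.
  have Tz : T (z, 0) by case: polar => _ _ -> _; exists 0; rewrite /fun_op /= ?linear0.
  rewrite mul_sym//; last by apply/domT; exists 0.
  case: Tm => _ _ /(_ _ _ Tz) h.
  have -> : mulL2 m z = 0 by apply: sqnorm_eq0; rewrite -h /sqnorm dotp0l.
  by rewrite dotp0r.
Qed.

Lemma modulus_mdom f g : A (f, g) -> mdom m f.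
Proof.
by move=> fg; apply/domT; exists (U g); case: polar => _ _ -> _; exists g.
Qed.

(** For [A (f, g)], the function [g - m f] is orthogonal to every element carried by
    a sublevel set of [m], by self-adjointness and the bounded case.  Test this
    against its own restrictions. *)
Lemma modulus_mul f g : A (f, g) -> \forall x \ae mu, g x = (m x)%:C * f x.
Proof.
move=> fg; have fd := modulus_mdom fg.
pose S := sublevel m.
have mS n : measurable (S n) by exact: measurable_sublevel.
pose z : L2 mu := g - mulL2 m f.
have key n : mulL2 \1_(S n) z = 0.
  set e := mulL2 _ z.
  have eE := restrE z (mS n).
  have ec : bounded_support n.+1%:R e.
    apply: filterS eE => x ->; rewrite indicE; case: (boolP (x \in S n)).
      by rewrite inE; left.
    by right; rewrite mul0r.
  have Ae := modulus_bounded (ltr0Sn R n) ec.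
  have ed := bounded_support_mdom (ler0n R n.+1) ec.
  have h := (selfadjointE _ _ sA).1 Ae _ _ fg.
  apply: sqnorm_eq0; rewrite /sqnorm.
  have -> : dotp e e = dotp z e.
    apply: L2_dot_ae; apply: filterS eE => x ->.
    by rewrite indicE bool_mul_conj.
  by rewrite dotpDl dotpNl h (mul_sym fd ed) subrr.
have h n : \forall x \ae mu, S n x -> g x = (m x)%:C * f x.
  have e0 : \forall x \ae mu, mulL2 \1_(S n) z x = 0 by rewrite key; exact: L2_0E.
  have zE : \forall x \ae mu, z x = g x - (m x)%:C * f x.
    by apply: filterS2 (L2_subE g (mulL2 m f)) (mul_ae fd) => x -> ->.
  apply: filterS3 e0 (restrE z (mS n)) zE => x -> + zx Snx.
  by rewrite zx indicE mem_set// mul1r => /esym/subr0_eq.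
apply: filterS (ae_foralln h) => x /(_ (Num.truncn (m x))); apply.
by rewrite /S /sublevel /= ltW// truncnS_gt.
Qed.

Lemma polar_mul f g : (\forall x \ae mu, g x = (m x)%:C * f x) -> T (f, U g).
Proof.
move=> gf; have fd : mdom m f.
  apply: (sqint_le ler01 _ (L2_sqint g)); first exact: cmeasurable_mul.
  by apply: filterS gf => x <-; rewrite mul1r.
have [y fy] := (domT f).2 fd.
have [u fu /= yu] : comp_op (fun_op U) A (f, y) by case: polar => _ _ <- _.
suff -> : g = u by rewrite -yu.
by apply/L2_eqP; apply: filterS2 gf (modulus_mul fu) => x -> ->.
Qed.

Lemma polar_kernel f : (\forall x \ae mu, m x = 0 \/ f x = 0) -> U f = 0.
Proof.
move=> mf; have fd : mdom m f.
  by apply: (mdom_bounded (lexx 0)) => //; apply: filterS mf => x [->|]; [left|right].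
case: polar => _ _ _ E; rewrite -[_ = _]/([set x | U x = 0] f) E.
have [y fy] := (domT f).2 fd.
suff y0 : y = 0 by rewrite y0 in fy.
apply: sqnorm_eq0; case: Tm => _ _ /(_ _ _ fy) ->.
have -> : mulL2 m f = 0.
  apply/L2_eqP; apply: filterS3 mf (mul_ae fd) (L2_0E mu) => x + -> ->.
  by move=> [->|->]; rewrite ?mul0r ?mulr0.
by rewrite /sqnorm dotp0l.
Qed.

Lemma polar_bounded :
  exists2 M : R, 0 <= M & forall f, sqnorm (U f) <= M * sqnorm f.
Proof.
case: polar => _ [[M UM] _] _ _; exists (M ^+ 2) => [|f]; first exact: sqr_ge0.
have sqE (H : innerProductType R) (x : H) : sqnorm x = hnorm x ^+ 2.
  by rewrite /hnorm sqr_sqrtr// sqnorm_ge0.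
have p (H : innerProductType R) (x : H) : 0 <= hnorm x by exact: sqrtr_ge0.
rewrite !sqE -exprMn lerXn2r ?nnegrE//.
exact: le_trans (UM f).
Qed.

Lemma modulus_dom f : opdom A f <-> mdom m f.
Proof.
split=> [[g]|fd]; first exact: modulus_mdom.
have [y fy] := (domT f).2 fd.
have [u fu _] : comp_op (fun_op U) A (f, y) by case: polar => _ _ <- _.
by exists u.
Qed.

Section Component.
Variables (phi : X -> X) (w : X -> R[i]) (h : X -> R).
Hypotheses (symb : wcomp_symbol mu phi w) (wh : weight_density mu phi w h).
Hypothesis hm : forall x, h x <= m x ^+ 2.
Variable P : K -> L2 mu.
Hypotheses (PB : forall x y, P (x - y) = P x - P y).
Hypotheses (Pn : forall x, sqnorm (P x) <= sqnorm x).
Hypothesis TP : forall f k, T (f, k) -> wcomp_op mu phi w (f, P k).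

(** The expected value of the component of [U] on [F]. *)
Let pull (F : X -> R[i]) x := w x * ((m (phi x))^-1%:C * F (phi x)).

Let mphi : measurable_fun setT phi. Proof. by case: symb. Qed.
Let mw : cmeasurable w. Proof. by case: symb. Qed.

Let cmV : cmeasurable (fun x => ((m x)^-1)%:C : R[i]).
Proof. by apply: cmeasurable_real; exact: measurable_invr. Qed.

Let mpull F : cmeasurable F -> cmeasurable (pull F).
Proof.
move=> mF; apply: cmeasurableM => //.
exact: (cmeasurable_comp mphi (cmeasurableM cmV mF)).
Qed.

Let pull_le F : cmeasurable F ->
  (\int[mu]_x sqmod (pull F) x <= \int[mu]_x sqmod F x)%E.
Proof.
move=> mF; have [h0 mh hE] := wh.
pose g := sqmod (fun x => (m x)^-1%:C * F x).
have mg : measurable_fun setT g by apply: measurable_sqmod; exact: cmeasurableM.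
under eq_integral do rewrite /sqmod /pull normcM exprMn EFinM.
rewrite -/(sqmod w _) (hE g)//; last by move=> x; exact: sqmod_ge0.
apply: ge0_le_integral => //.
- by move=> x _; rewrite mule_ge0 ?sqmod_ge0// lee_fin.
- by apply: emeasurable_funM => //; exact/measurable_EFinP.
- exact: measurable_sqmod.
- move=> x _; rewrite /g /sqmod -EFinM lee_fin normcM normc_real exprMn mulrA.
  rewrite ler_piMl ?sqr_ge0// real_normK ?num_real//.
  have [->|mx] := eqVneq (m x) 0; first by rewrite invr0 expr0n mulr0.
  by rewrite exprVn ler_pdivrMr ?mul1r// exprn_gt0// lt_def mx m0.
Qed.

(** The formula is immediate on the range of [A], where [U (m r) = T r], and for
    functions carried by the zero set of [m], where both sides vanish.  A function
    cut off to a set where [1 / m] is bounded is a sum of two such functions, and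
    both sides of the formula are continuous in [f]. *)
Lemma polar_component f : \forall x \ae mu,
  P (U f) x = w x * ((m (phi x))^-1%:C * f (phi x)).
Proof.
have sqpull g : pull g \in sqint mu.
  rewrite inE; split; first exact/mpull/cmeasurable_L2.
  by apply: le_lt_trans (pull_le (cmeasurable_L2 g)) _; rewrite -L2_sqnorm ltry.
pose Q g : L2 mu := L2_of mu (pull g).
have QE g : \forall x \ae mu, Q g x = pull g x by exact: L2_ofE.
have Qn g : sqnorm (Q g) <= sqnorm g.
  by rewrite -lee_fin L2_of_sqnorm// L2_sqnorm; exact/pull_le/cmeasurable_L2.
have QB g g' : Q (g - g') = Q g - Q g'.
  apply/L2_eqP.
  have gg' : \forall x \ae mu, (m x)^-1%:C * (g - g' : L2 mu) x =
      (m x)^-1%:C * (g x - g' x).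
    by apply: filterS (L2_subE g g') => x ->.
  have h1 : \forall x \ae mu, Q (g - g') x = pull (fun x => g x - g' x) x.
    by apply: filterS2 (QE (g - g')) (wcomp_ae symb gg') => x ->; rewrite /pull => ->.
  have h2 : \forall x \ae mu, (Q g - Q g' : L2 mu) x = pull g x - pull g' x.
    by apply: filterS3 (L2_subE (Q g) (Q g')) (QE g) (QE g') => x -> -> ->.
  by apply: filterS2 h1 h2 => x -> ->; rewrite /pull !mulrBr.
suff E : P (U f) = Q f by rewrite E; exact: QE.
apply/eqP; rewrite -subr_eq0; apply/eqP; apply: sqnorm_eq0; apply/eqP.
rewrite eq_le sqnorm_ge0 andbT; apply/ler_addgt0Pr => e e0; rewrite add0r.
have [M M0 UM] := polar_bounded.
have M1 : 0 < 2 * (M + 1) by rewrite mulr_gt0// ltr_wpDl.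
have mV := measurable_invr m0 mm.
have [n] := sublevel_tail f mV (divr_gt0 e0 M1).
set fn := mulL2 _ f => ffn.
have fnE := restrE f (measurable_sublevel n mV); rewrite -/fn in fnE; clearbody fn.
have Ufn : P (U fn) = Q fn.
  have fnV : (fun x => (m x)^-1%:C * fn x) \in sqint mu.
    apply: (sqint_le (ler0n R n.+1) _ (L2_sqint fn)).
      by apply: cmeasurableM => //; exact: cmeasurable_L2.
    apply: filterS fnE => x ->; rewrite !normcM !normc_real indicE.
    case: (boolP (x \in _)); last by rewrite normr0 mul0r !mulr0.
    rewrite inE normr1 mul1r /sublevel /= => Vn; rewrite ler_wpM2r ?normc_ge0//.
    by rewrite ger0_norm ?invr_ge0.
  have [r rE] : exists r : L2 mu, \forall x \ae mu, r x = (m x)^-1%:C * fn x.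
    by exists (L2_of mu (fun x => (m x)^-1%:C * fn x)); exact: L2_ofE.
  have rd : mdom m r.
    apply: (sqint_le ler01 _ (L2_sqint fn)); first exact: cmeasurable_mul.
    apply: filterS rE => x ->; rewrite mul1r mulrA -rmorphM normcM normc_real.
    rewrite ler_piMl ?normc_ge0//; have [->|mx] := eqVneq (m x) 0.
      by rewrite mul0r normr0.
    by rewrite divff// normr1.
  have pE : \forall x \ae mu, m x = 0 \/ (fn - mulL2 m r : L2 mu) x = 0.
    apply: filterS3 (L2_subE fn (mulL2 m r)) (mul_ae rd) rE => x E1 E2 E3.
    rewrite E1 E2 E3.
    have [->|mx] := eqVneq (m x) 0; [by left|right].
    by rewrite mulrA -rmorphM divff// rmorph1 mul1r subrr.
  have -> : U fn = U (mulL2 m r).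
    by apply/eqP; rewrite -subr_eq0 -raddfB; apply/eqP; exact: polar_kernel.
  have := TP (polar_mul (mul_ae rd)); rewrite /wcomp_op /= => h1.
  apply/L2_eqP; apply: filterS3 h1 (wcomp_ae symb rE) (QE fn) => x -> ->.
  by rewrite /pull => ->.
have -> : P (U f) - Q f = P (U (f - fn)) - Q (f - fn).
  by rewrite raddfB PB QB Ufn opprB addrA subrK.
apply: le_trans (sqnormD_le _ _) _; rewrite sqnormN.
have h1 := le_trans (Pn (U (f - fn))) (UM (f - fn)).
have h2 := Qn (f - fn).
move: ffn; rewrite ltr_pdivlMr// => h3; nra.
Qed.

End Component.
End Modulus.
End Polar.

(** * Domains of products, powers and means *)

Section TupleDomains.
Context (R : realType) (H : innerProductType R).
Implicit Types (S T a b : operator H H) (s : seq (operator H H)).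

Lemma opdom_comp S T x : opdom (comp_op S T) x <-> exists2 y, T (x, y) & opdom S y.
Proof.
split=> [[z [y Txy Syz]]|[y Txy [z Syz]]]; first by exists y => //; exists z.
by exists z, y.
Qed.

Lemma joint_dom_cons a s x : joint_dom (a :: s) x <-> opdom a x /\ joint_dom s x.
Proof. by rewrite /joint_dom big_cons. Qed.

Lemma joint_dom2 a b x : joint_dom [:: a; b] x <-> opdom a x /\ opdom b x.
Proof. by rewrite /joint_dom !big_cons big_nil setIT. Qed.

(** A product is only defined where its right factor is. *)
Lemma joint_dom_mul a b s : joint_dom (tuple_mul [:: a; b] s) `<=` joint_dom s.
Proof.
move=> x; rewrite /tuple_mul /= cats0 /joint_dom big_cat /= => -[+ _].
elim: s => [|t s IH] /=; first by rewrite !big_nil.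
rewrite !big_cons => -[/opdom_comp[y ty _] /IH hs]; split => //.
by exists y.
Qed.

Lemma joint_dom_pow a b k : (1 < k)%N ->
  joint_dom (tuple_pow [:: a; b] k) `<=` joint_dom (tuple_pow [:: a; b] 2).
Proof.
case: k => [|[|k]] // _; rewrite /tuple_pow !iteropS.
elim: k => [//|k IH] x; rewrite iterS => /joint_dom_mul; exact: IH.
Qed.

Lemma joint_dom_pow2 a b x : joint_dom (tuple_pow [:: a; b] 2) x <->
  [/\ opdom (comp_op a a) x, opdom (comp_op a b) x,
      opdom (comp_op b a) x & opdom (comp_op b b) x].
Proof.
rewrite /tuple_pow /tuple_mul /= !joint_dom_cons /joint_dom big_nil.
by split=> [[? [? [? [? _]]]]|[]].
Qed.

Lemma opdom_mean (l : R) (V : H -> H) (A : operator H H) x :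
  opdom (mean_op l V A) x <-> opdom A x /\ opdom A (V x).
Proof.
split=> [[y [y1 [y2 [[u [v Av _] _] [z [t tE At] _] _]]]]|[[v Av] [z Az]]].
  by split; [exists v|exists z; rewrite -(tE : t = V x)].
exists (l%:C *: V v + (1 - l)%:C *: z), (l%:C *: V v), ((1 - l)%:C *: z).
by split=> //=; [exists (V v) => //; exists v|exists z => //; exists (V x)].
Qed.

End TupleDomains.

(** * Weighted composition operators *)

Section Weighted.
Context d (X : measurableType d) (R : realType).
Variable mu : {measure set X -> \bar R}.
Implicit Types (f g : L2 mu) (m : X -> R).

Lemma sqintE (F : X -> R[i]) :
  F \in sqint mu <-> cmeasurable F /\ (\int[mu]_x sqmod F x < +oo)%E.
Proof. by rewrite inE. Qed.

Lemma mdomE m f : mdom m f <-> cmeasurable (fun x => (m x)%:C * f x) /\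
  (\int[mu]_x sqmod (fun x => (m x)%:C * f x)%R x < +oo)%E.
Proof. exact: sqintE. Qed.

Lemma mulL2_sqnorm m f : mdom m f -> (sqnorm (mulL2 m f))%:E =
  (\int[mu]_x sqmod (fun x => (m x)%:C * f x)%R x)%E.
Proof. exact: L2_of_sqnorm. Qed.

Lemma mdom_le m f g (c : R) : 0 <= c -> measurable_fun setT m -> mdom m g ->
  (\forall x \ae mu, normc (f x) <= c * normc (g x)) -> mdom m f.
Proof.
move=> c0 mm gd fg; apply: (sqint_le c0 _ gd); first exact: cmeasurable_mul.
apply: filterS fg => x fg; rewrite !normcM mulrCA ler_wpM2l ?normc_ge0//.
Qed.

Lemma mdom_restr m f (S : set X) : measurable_fun setT m -> measurable S ->
  mdom m f -> mdom m (mulL2 \1_S f).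
Proof.
move=> mm mS fd; apply: (mdom_le ler01 mm fd).
apply: filterS (restrE f mS) => x ->; rewrite normcM normc_real.
by rewrite ler_wpM2r ?normc_ge0// indic_le1.
Qed.

Lemma measurable_sqrtr (h : X -> R) : (forall x, 0 <= h x) ->
  measurable_fun setT h -> measurable_fun setT (fun x => Num.sqrt (h x)).
Proof.
move=> h0 mh; rewrite (_ : (fun _ => _) = (fun x => powR x 2^-1) \o h).
  by apply: measurableT_comp => //; exact: measurable_powR.
by apply/funext => x /=; rewrite powR12_sqrt.
Qed.

Section OneWeight.
Variables (phi : X -> X) (w : X -> R[i]) (h : X -> R).
Hypotheses (symb : wcomp_symbol mu phi w) (wh : weight_density mu phi w h).

Let mphi : measurable_fun setT phi. Proof. by case: symb. Qed.
Let mw : cmeasurable w. Proof. by case: symb. Qed.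
Let h0 x : 0 <= h x. Proof. by case: wh. Qed.
Let mh : measurable_fun setT h. Proof. by case: wh. Qed.

(** The integral of [|w|^2] over the set where [h o phi = 0] is the integral of [h]
    over its own zero set. *)
Lemma weight_density_zero : \forall x \ae mu, h (phi x) = 0 -> w x = 0.
Proof.
pose Z := h @^-1` [set 0].
have mZ : measurable Z by rewrite -[Z]setTI; exact: mh.
have mI : measurable_fun setT (fun x => (\1_Z x)%:E : \bar R).
  exact/measurable_EFinP/measurable_indic.
pose F x := (sqmod w x * (\1_Z (phi x))%:E)%E.
have mF : measurable_fun setT F.
  apply: emeasurable_funM; first exact: measurable_sqmod.
  exact: (measurableT_comp mI mphi).
have F0 : (\int[mu]_x `|F x| = 0)%E.
  under eq_integral do rewrite gee0_abs ?mule_ge0 ?sqmod_ge0 ?lee_fin//.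
  case: wh => _ _ /(_ (fun x => (\1_Z x)%:E) mI) ->//.
  apply: integral0_eq => x _; rewrite indicE; case: (boolP (x \in Z)).
    by rewrite inE => ->; rewrite mul0e.
  by rewrite mule0.
have := (ae_eq_integral_abs mu measurableT mF).1 F0.
apply: filterS => x /= /(_ I) + hx.
rewrite /F indicE mem_set// mule1 /sqmod => -[/eqP].
by rewrite sqrf_eq0 => /eqP/eq0_normc.
Qed.

(** Both sides may be infinite, so this gives the domain and the norms at once. *)
Lemma wcomp_sqmod_integral f :
  (\int[mu]_x sqmod (fun x => w x * f (phi x))%R x =
   \int[mu]_x sqmod (fun x => (Num.sqrt (h x))%:C * f x)%R x)%E.
Proof.
under eq_integral do rewrite /sqmod normcM exprMn EFinM.
under [RHS]eq_integral do rewrite /sqmod normcM normc_real exprMn real_normK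
  ?num_real// sqr_sqrtr// EFinM.
case: wh => _ _ /(_ (sqmod f)); apply; last by move=> x; exact: sqmod_ge0.
exact/measurable_sqmod/cmeasurable_L2.
Qed.

Lemma norm_density_wcomp :
  norm_density (wcomp_op mu phi w) (fun x => Num.sqrt (h x)).
Proof.
have mf f : cmeasurable (fun x => w x * f (phi x)).
  apply: cmeasurableM => //.
  exact: (cmeasurable_comp mphi (cmeasurable_L2 f)).
have ms := measurable_sqrtr h0 mh.
have domE f : opdom (wcomp_op mu phi w) f <-> mdom (fun x => Num.sqrt (h x)) f.
  rewrite (wcomp_op_dom f symb) mdomE sqintE wcomp_sqmod_integral.
  by split=> -[_ ?]; split => //; exact: cmeasurable_mul.
split=> //; first by case: (wcomp_op_is_operator symb).
move=> f k fk; have /domE fd : opdom (wcomp_op mu phi w) f by exists k.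
apply: EFin_inj; rewrite (mulL2_sqnorm fd) L2_sqnorm -wcomp_sqmod_integral.
by apply: integral_sqmod_ae => //; exact: cmeasurable_L2.
Qed.

Lemma wcomp_fun f g g' : wcomp_op mu phi w (f, g) -> wcomp_op mu phi w (f, g') ->
  g = g'.
Proof.
by move=> h1 h2; apply/L2_eqP; apply: filterS2 h1 h2 => x /= -> ->.
Qed.

(** [T] is an operator one of whose components, selected by [P], is the weighted
    composition operator: the whole of it, or an entry of a column. *)
Section ComponentOf.
Variables (K : innerProductType R) (T : operator (L2 mu) K) (m : X -> R).
Hypotheses (mm : measurable_fun setT m) (m0 : forall x, 0 <= m x).
Hypothesis Tm : norm_density T m.
Variables (U : {linear L2 mu -> K}) (A : operator (L2 mu) (L2 mu)).
Hypothesis polar : polar_decomposition T U A.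
Hypothesis hm : forall x, h x <= m x ^+ 2.
Variable P : K -> L2 mu.
Hypotheses (PB : forall x y, P (x - y) = P x - P y).
Hypotheses (Pn : forall x, sqnorm (P x) <= sqnorm x).
Hypothesis TP : forall f k, T (f, k) -> wcomp_op mu phi w (f, P k).

Let PU := polar_component mm m0 Tm polar symb wh hm PB Pn TP.

(** Where [1 / m <= c] after composition with [phi], the component of [U] is
    dominated by [c] times the weighted composition operator. *)
Lemma component_restr_below (S : set X) (c : R) f (y : L2 mu) :
  measurable S -> 0 <= c ->
  (forall x, S x -> (m x)^-1 <= c) ->
  wcomp_op mu phi w (f, y) -> mdom m y -> mdom m (P (U (mulL2 \1_S f))).
Proof.
move=> mS c0 Sc fy yd; apply: (mdom_le c0 mm yd).
have fyE : \forall x \ae mu, y x = w x * f (phi x) := fy.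
have E1 := PU (mulL2 \1_S f); have E2 := wcomp_ae_pull symb (restrE f mS).
apply: filterS3 E1 fyE E2.
move=> x -> -> E.
rewrite !normcM normc_real; case: E => [->|->]; last first.
  by rewrite normc0 !mul0r !mulr0.
rewrite normcM normc_real indicE ger0_norm ?invr_ge0//.
case: (boolP (_ \in S)); last by rewrite normr0 mul0r !mulr0 !mulr_ge0 ?normc_ge0.
rewrite inE normr1 mul1r => /Sc Sm.
by rewrite mulrCA ler_wpM2r// mulr_ge0 ?normc_ge0.
Qed.

(** Conversely, the weighted composition operator is [m o phi] times the component of
    [U]; points with [m (phi x) = 0] are harmless because [w] vanishes there. *)
Lemma wcomp_restr_above (S : set X) (c : R) f : measurable S -> 0 <= c ->
  (forall x, S x -> m x <= c) -> mdom m f -> mdom m (P (U f)) ->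
  exists2 y, wcomp_op mu phi w (mulL2 \1_S f, y) & mdom m y.
Proof.
move=> mS c0 Sc fd Ufd; have fSd := mdom_restr mm mS fd.
have [k fSk] : opdom T (mulL2 \1_S f).
  by case: Tm => _ domE _; exact/domE.
exists (P k); first exact: TP.
have fSP : \forall x \ae mu, P k x = w x * mulL2 \1_S f (phi x) := TP fSk.
apply: (mdom_le c0 mm Ufd).
have E : \forall x \ae mu, w x = 0 \/ h (phi x) != 0 /\
    mulL2 \1_S f (phi x) = (\1_S (phi x))%:C * f (phi x).
  apply: filterS2 (wcomp_ae_pull symb (restrE f mS)) weight_density_zero => x.
  move=> [sx|->]; last by left.
  have [hx|hx] := eqVneq (h (phi x)) 0; first by move=> /(_ hx); left.
  by right.
apply: filterS3 (PU f) fSP E => x -> -> [->|[hx ->]].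
  by rewrite !mul0r normc0 mulr0.
rewrite !normcM !normc_real indicE [leRHS]mulrCA ler_wpM2l ?normc_ge0//.
rewrite [leRHS]mulrA ler_wpM2r ?normc_ge0//.
case: (boolP (_ \in S)); last by rewrite normr0 mulr_ge0.
rewrite inE normr1 => /Sc; rewrite ger0_norm ?invr_ge0//.
have mp : 0 < m (phi x).
  rewrite lt_def m0 andbT; apply: contra hx => /eqP mx.
  by have := hm (phi x); rewrite mx expr0n /= => hx; rewrite eq_le hx h0.
by rewrite ler_pdivlMr// mul1r.
Qed.

End ComponentOf.

(** With [m = sqrt h] the mean sends [f] to [(l + (1 - l) * m / (m o phi)) * C f], and
    the factor is at least [l]. *)
Lemma mean_dominates (V : {linear L2 mu -> L2 mu}) A (l : R) f (y c : L2 mu) :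
  0 < l < 1 -> polar_decomposition (wcomp_op mu phi w) V A ->
  mean_op l V A (f, y) -> wcomp_op mu phi w (f, c) ->
  \forall x \ae mu, normc (c x) <= l^-1 * normc (y x).
Proof.
move=> /andP[l0 l1] polar; have ms := measurable_sqrtr h0 mh.
have s0 x : 0 <= Num.sqrt (h x) by exact: sqrtr_ge0.
have hm x : h x <= Num.sqrt (h x) ^+ 2 by rewrite sqr_sqrtr.
have Tm := norm_density_wcomp.
have VE := polar_component ms s0 Tm polar symb wh hm (P := id)
  (fun _ _ => erefl) (fun _ => lexx _) (fun _ _ => id) f.
move=> [y1 [y2 [[u [v Av uE] y1E] [z [t tE At] y2E] yE]]] fc.
rewrite (tE : t = V f) /= in At; rewrite /= in y1E y2E yE.
have uc : u = c.
  by apply: (wcomp_fun _ fc); case: polar => _ _ -> _; exists v.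
rewrite yE y1E y2E uc.
have zE := modulus_mul ms s0 Tm polar At.
have sE : \forall x \ae mu, (l%:C *: c + (1 - l)%:C *: z : L2 mu) x =
    l%:C * c x + (1 - l)%:C * (z : L2 mu) x.
  by apply: filterS2 (L2_linE l%:C c ((1 - l)%:C *: z)) (L2_scaleE (1 - l)%:C z)
    => x -> ->.
have cz : \forall x \ae mu,
    (z : L2 mu) x = (Num.sqrt (h x) / Num.sqrt (h (phi x)))%:C * c x.
  have fcE : \forall x \ae mu, c x = w x * f (phi x) := fc.
  apply: filterS3 zE VE fcE => x -> -> ->.
  by rewrite rmorphM -!mulrA; congr (_ * _); rewrite mulrCA.
apply: filterS2 sE cz => x -> ->.
rewrite mulrA -mulrDl -rmorphM -rmorphD normcM normc_real mulrA ler_peMl ?normc_ge0//.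
have p : 0 <= (1 - l) * (Num.sqrt (h x) / Num.sqrt (h (phi x))).
  by rewrite mulr_ge0 ?divr_ge0// subr_ge0 ltW.
by rewrite mulrC ler_pdivlMr// mul1r ger0_norm ?lerDl// addr_ge0// ltW.
Qed.

Lemma polar_dom (K : innerProductType R) (T : operator (L2 mu) K)
    (V : {linear L2 mu -> K}) A f : polar_decomposition T V A ->
  opdom A f <-> opdom T f.
Proof.
case=> _ _ -> _; split=> [[g fg]|[k [g fg _]]]; last by exists g.
by exists (V g); exists g.
Qed.

End OneWeight.

(** The values of the inner operators are compared by [mean_dominates], and domains of
    multiplication operators are stable under domination. *)
Lemma mean_product_dom phi w h phi' w' h' (V V' : {linear L2 mu -> L2 mu}) A A'
    (l : R) f : 0 < l < 1 ->
  wcomp_symbol mu phi w -> wcomp_symbol mu phi' w' ->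
  weight_density mu phi w h -> weight_density mu phi' w' h' ->
  polar_decomposition (wcomp_op mu phi w) V A ->
  polar_decomposition (wcomp_op mu phi' w') V' A' ->
  opdom (comp_op (mean_op l V A) (mean_op l V' A')) f ->
  opdom (comp_op (wcomp_op mu phi w) (wcomp_op mu phi' w')) f.
Proof.
move=> l01 symb symb' wh wh' polar polar' /opdom_comp[y My /opdom_mean[Ay _]].
have [_ domE _] := norm_density_wcomp symb wh.
have [h0 mh _] := wh.
have /opdom_mean[/(polar_dom _ polar')[c fc] _] : opdom (mean_op l V' A') f by exists y.
apply/opdom_comp; exists c => //; apply/domE.
have /domE yd := (polar_dom _ polar).1 Ay.
apply: (mdom_le _ (measurable_sqrtr h0 mh) yd); last first.
  exact: (mean_dominates symb' wh' l01 polar' My fc).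
by case/andP: l01 => l0 _; rewrite invr_ge0 ltW.
Qed.

Lemma sqnorm_pair (H K : innerProductType R) (x : H * K) :
  sqnorm x = sqnorm x.1 + sqnorm x.2.
Proof. by rewrite /sqnorm /= -raddfD. Qed.

Lemma norm_density_column (K L : innerProductType R) (S : operator (L2 mu) K)
    (T : operator (L2 mu) L) (m1 m2 m : X -> R) :
  measurable_fun setT m1 -> measurable_fun setT m2 -> measurable_fun setT m ->
  (forall x, m x ^+ 2 = m1 x ^+ 2 + m2 x ^+ 2) ->
  norm_density S m1 -> norm_density T m2 -> norm_density (column_op S T) m.
Proof.
move=> mm1 mm2 mm mE [Slin Sdom Sn] [Tlin Tdom Tn].
have sqE f : (\int[mu]_x sqmod (fun x => (m x)%:C * f x)%R x =
    \int[mu]_x sqmod (fun x => (m1 x)%:C * f x)%R x +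
    \int[mu]_x sqmod (fun x => (m2 x)%:C * f x)%R x)%E.
  rewrite -ge0_integralD//; last 4 first.
  - by move=> x _; exact: sqmod_ge0.
  - exact/measurable_sqmod/cmeasurable_mul.
  - by move=> x _; exact: sqmod_ge0.
  - exact/measurable_sqmod/cmeasurable_mul.
  apply: eq_integral => x _; rewrite /sqmod -EFinD !normcM !normc_real !exprMn.
  by rewrite !real_normK ?num_real// mE mulrDl.
have i0 (F : X -> R[i]) : (0 <= \int[mu]_x sqmod F x)%E.
  by apply: integral_ge0 => x _; exact: sqmod_ge0.
have mdomD f : mdom m f <-> mdom m1 f /\ mdom m2 f.
  rewrite !mdomE !sqE; split=> [[_ h]|[[_ h1] [_ h2]]].
    by split; split; try exact: cmeasurable_mul; apply: le_lt_trans h;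
      [rewrite leeDl|rewrite leeDr].
  by split; [exact: cmeasurable_mul|exact: lte_add_pinfty].
have domE f : opdom (column_op S T) f <-> opdom S f /\ opdom T f.
  split=> [[k [Sk Tk]]|[[k Sk] [k' Tk]]].
    by split; [exists k.1|exists k.2].
  by exists (k, k').
split.
- move=> a [u1 [u2 u3]] [v1 [v2 v3]] [/= u12 u13] [/= v12 v13]; split => /=.
    exact: Slin a _ _ u12 v12.
  exact: Tlin a _ _ u13 v13.
- by move=> f; rewrite domE mdomD Sdom Tdom.
- move=> f k [fk1 fk2]; rewrite sqnorm_pair (Sn _ _ fk1) (Tn _ _ fk2).
  have d1 : mdom m1 f by apply/Sdom; exists k.1.
  have d2 : mdom m2 f by apply/Tdom; exists k.2.
  have dm : mdom m f by apply/mdomD.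
  apply: EFin_inj; rewrite EFinD.
  rewrite [X in (X + _)%E](mulL2_sqnorm d1).
  rewrite [X in (_ + X)%E](mulL2_sqnorm d2).
  by rewrite [RHS](mulL2_sqnorm dm); exact/esym/sqE.
Qed.

End Weighted.

(** * The spherical mean transform of a pair *)

Section SphericalMean.
Context d (X : measurableType d) (R : realType).
Variable mu : {measure set X -> \bar R}.
Implicit Types (f : L2 mu).
Variables (phi1 phi2 : X -> X) (w1 w2 : X -> R[i]) (h1 h2 : X -> R).
Hypotheses (symb1 : wcomp_symbol mu phi1 w1) (symb2 : wcomp_symbol mu phi2 w2).
Hypotheses (wh1 : weight_density mu phi1 w1 h1).
Hypotheses (wh2 : weight_density mu phi2 w2 h2).
Let C1 := wcomp_op mu phi1 w1.
Let C2 := wcomp_op mu phi2 w2.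
Variables (U : {linear L2 mu -> (L2 mu * L2 mu)%type}).
Variables (A : operator (L2 mu) (L2 mu)) (l : R).
Hypothesis polar : polar_decomposition (column_op C1 C2) U A.
Let M1 := mean_op l (fun f => (U f).1) A.
Let M2 := mean_op l (fun f => (U f).2) A.
Let m x := Num.sqrt (h1 x + h2 x).

Let h10 x : 0 <= h1 x. Proof. by case: wh1. Qed.
Let h20 x : 0 <= h2 x. Proof. by case: wh2. Qed.
Let h120 x : 0 <= h1 x + h2 x. Proof. by rewrite addr_ge0. Qed.
Let mh1 : measurable_fun setT h1. Proof. by case: wh1. Qed.
Let mh2 : measurable_fun setT h2. Proof. by case: wh2. Qed.
Let mm : measurable_fun setT m.
Proof. by apply: measurable_sqrtr => //; exact: measurable_funD. Qed.
Let m0 x : 0 <= m x. Proof. exact: sqrtr_ge0. Qed.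

Let Tm : norm_density (column_op C1 C2) m.
Proof.
apply: (norm_density_column (measurable_sqrtr h10 mh1)
  (measurable_sqrtr h20 mh2) mm).
- by move=> x; rewrite !sqr_sqrtr.
- exact: norm_density_wcomp.
- exact: norm_density_wcomp.
Qed.

Let hm1 x : h1 x <= m x ^+ 2. Proof. by rewrite sqr_sqrtr// lerDl. Qed.
Let hm2 x : h2 x <= m x ^+ 2. Proof. by rewrite sqr_sqrtr// lerDr. Qed.
Let fst_le (x : L2 mu * L2 mu) : sqnorm x.1 <= sqnorm x.
Proof. by rewrite [leRHS]sqnorm_pair lerDl sqnorm_ge0. Qed.
Let snd_le (x : L2 mu * L2 mu) : sqnorm x.2 <= sqnorm x.
Proof. by rewrite [leRHS]sqnorm_pair lerDr sqnorm_ge0. Qed.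

Let column_dom f : mdom m f <-> opdom C1 f /\ opdom C2 f.
Proof.
have [_ <- _] := Tm; split=> [[k [fk1 fk2]]|[[k fk] [k' fk']]].
  by split; [exists k.1|exists k.2].
by exists (k, k').
Qed.

(** [C_1] and [C_2] can both be applied to [y] exactly when [m y] is in [L^2]. *)
Let square_dom f : joint_dom (tuple_pow [:: C1; C2] 2) f <->
  (exists2 y, C1 (f, y) & mdom m y) /\ (exists2 y, C2 (f, y) & mdom m y).
Proof.
split=> [/joint_dom_pow2[/opdom_comp[a fa a1] /opdom_comp[b fb b1]
    /opdom_comp[a' fa' a2] /opdom_comp[b' fb' b2]]|].
  split; [exists a => //|exists b => //]; apply/column_dom; split=> //.
    by rewrite (wcomp_fun fa fa').
  by rewrite (wcomp_fun fb fb').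
move=> [[a fa /column_dom[a1 a2]] [b fb /column_dom[b1 b2]]].
apply/joint_dom_pow2.
by split; apply/opdom_comp; [exists a|exists b|exists a|exists b].
Qed.

Let spherical_dom f : joint_dom [:: M1; M2] f <->
  [/\ mdom m f, mdom m (U f).1 & mdom m (U f).2].
Proof.
rewrite joint_dom2 !opdom_mean !(modulus_dom Tm polar).
by split=> [[[? ?] [_ ?]]|[]].
Qed.

(** Cut [f] off to the sets where [1 / m] is bounded; these include the zero set
    of [m]. *)
Lemma square_spherical :
  hdense (joint_dom (tuple_pow [:: C1; C2] 2)) -> hdense (joint_dom [:: M1; M2]).
Proof.
move=> dC; apply: hdense_approx dC _ => f e.
move=> /square_dom[[y1 fy1 y1d] [y2 fy2 y2d]] e0.
have mV := measurable_invr m0 mm.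
have mS n := measurable_sublevel n mV.
have [n fn] := sublevel_tail f mV e0.
exists (mulL2 \1_(sublevel (fun x => (m x)^-1) n) f) => //; apply/spherical_dom; split.
- apply: mdom_restr => //; apply/column_dom.
  by split; [exists y1|exists y2].
- apply: (component_restr_below symb1 wh1 mm m0 Tm polar hm1 (P := fst)
    (fun _ _ => erefl) fst_le _ (mS n) _ (fun _ => id) fy1 y1d) => //.
  by move=> g k [].
- apply: (component_restr_below symb2 wh2 mm m0 Tm polar hm2 (P := snd)
    (fun _ _ => erefl) snd_le _ (mS n) _ (fun _ => id) fy2 y2d) => //.
  by move=> g k [].
Qed.

(** Cut [f] off to the sets where [m] is bounded. *)
Lemma spherical_square :
  hdense (joint_dom [:: M1; M2]) -> hdense (joint_dom (tuple_pow [:: C1; C2] 2)).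
Proof.
move=> dM; apply: hdense_approx dM _ => f e /spherical_dom[fd U1d U2d] e0.
have mS n := measurable_sublevel n mm.
have [n fn] := sublevel_tail f mm e0.
exists (mulL2 \1_(sublevel m n) f) => //; apply/square_dom; split.
- apply: (wcomp_restr_above symb1 wh1 mm m0 Tm polar hm1 (P := fst)
    (fun _ _ => erefl) fst_le _ (mS n) _ (fun _ => id) fd U1d) => //.
  by move=> g k [].
- apply: (wcomp_restr_above symb2 wh2 mm m0 Tm polar hm2 (P := snd)
    (fun _ _ => erefl) snd_le _ (mS n) _ (fun _ => id) fd U2d) => //.
  by move=> g k [].
Qed.

End SphericalMean.

Theorem proposition28 (R : realType) (d : measure_display)
  (X : measurableType d) (mu : {sigma_finite_measure set X -> \bar R})
  (phi1 phi2 : X -> X) (w1 w2 : X -> R[i])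
  (symb1 : wcomp_symbol mu phi1 w1) (symb2 : wcomp_symbol mu phi2 w2)
  (C1 := wcomp_op mu phi1 w1) (C2 := wcomp_op mu phi2 w2)
  (dense1 : hdense (opdom C1)) (dense2 : hdense (opdom C2))
  (lambda : R) (lambda_gt0 : 0 < lambda) (lambda_lt1 : lambda < 1)
  (V1 V2 : {linear L2 mu -> L2 mu}) (A1 A2 : operator (L2 mu) (L2 mu))
  (polar1 : polar_decomposition C1 V1 A1)
  (polar2 : polar_decomposition C2 V2 A2)
  (U : {linear L2 mu -> (L2 mu * L2 mu)%type}) (A : operator (L2 mu) (L2 mu))
  (polar : polar_decomposition (column_op C1 C2) U A)
  (toral := [:: mean_op lambda V1 A1; mean_op lambda V2 A2])
  (spherical := [:: mean_op lambda (fun f => (U f).1) A;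
                    mean_op lambda (fun f => (U f).2) A]) :
  [/\ (exists2 k : nat, (1 < k)%N &
         jointly_densely_defined (tuple_pow toral k)) ->
      (exists2 k : nat, (1 < k)%N &
         jointly_densely_defined (tuple_pow [:: C1; C2] k)),
      (exists2 k : nat, (1 < k)%N &
         jointly_densely_defined (tuple_pow [:: C1; C2] k)) ->
      jointly_densely_defined spherical
    & jointly_densely_defined spherical ->
      jointly_densely_defined (tuple_pow [:: C1; C2] 2)].
Proof.
have [h1 wh1] := weight_density_exists symb1 dense1.
have [h2 wh2] := weight_density_exists symb2 dense2.
have l01 : 0 < lambda < 1 by rewrite lambda_gt0.
split.
- move=> [k k1 /(hdense_sub (joint_dom_pow k1)) dM]; exists 2%N => //.
  apply: hdense_sub dM => f /joint_dom_pow2[f11 f12 f21 f22].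
  apply/joint_dom_pow2; split.
  + exact: (mean_product_dom l01 symb1 symb1 wh1 wh1 polar1 polar1 f11).
  + exact: (mean_product_dom l01 symb1 symb2 wh1 wh2 polar1 polar2 f12).
  + exact: (mean_product_dom l01 symb2 symb1 wh2 wh1 polar2 polar1 f21).
  + exact: (mean_product_dom l01 symb2 symb2 wh2 wh2 polar2 polar2 f22).
- move=> [k k1 /(hdense_sub (joint_dom_pow k1)) dC].
  exact: (square_spherical symb1 symb2 wh1 wh2 lambda polar).
- exact: (spherical_square symb1 symb2 wh1 wh2 polar).
Qed.
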